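(* There exist constants $\delta>0$ and $c_\delta>0$ such that, with $\tilde\delta=c_\delta\delta^2$, the following holds. Assume Assumption 1 (i), (iii) and Assumption 2 (as given in the context). Let $0<\eta\le\frac12$, $1\le\rho\le\frac1{8\eta^2}$, $0<\tau\le\sqrt{\tilde\delta}/L_F$, $c_b>0$, $b\ge1$ be constants independent of $T$, put $\tilde L_F=L_F+\frac{\tau L_F^2}{\delta}+3\delta\tau L_F^2$, and let $\{(x^k,B^k,\Lambda^k)\}$ be generated by DualHash-StoRM with $$\eta_k=\frac{\eta}{\tilde L_FT^{1/3}},\qquad \rho_k=\frac{8\rho\eta^2}{T^{2/3}}\quad(k\ge1),\qquad b_1=c_bT^{1/3},\qquad b_k=b\ \ (k>1).$$ Then there are positive constants $\tilde L_\Delta,\tilde C_\sigma$, independent of $T$ and depending on $(L_F,\eta,\rho,\tau,\delta)$, such that for a given $\varepsilon>0$, provided that $T$ satisfies $$T=\left\lceil\frac{\Big(\tilde L_\Delta\tilde\Delta_1+\tilde C_\sigma\big(\frac{\sigma^2}{4\rho\eta^2c_b}+\frac{32\rho\eta^2\sigma^2}{b}\big)\Big)^{3/2}}{\varepsilon^3}\right\rceil ,$$ where $\tilde\Delta_1=\Psi^1_{\rm storm}-\Psi^*_{\rm storm}$ is the initial Lyapunov function value gap, then for $R$ selected uniformly from $\{2,\dots,T+1\}$, $$\mathbb E\big[\mathrm{dist}^2(0,\partial\mathcal L(x^R,B^R,\Lambda^R))\big]\le\varepsilon^2 .$$ Moreover, the total number of stochastic first-order oracle (SFO) calls is of order $\mathcal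 O(\varepsilon^{-3})$.
   Context: Setting. $\mathcal X$ is a finite-dimensional real Hilbert space; $\mathcal B=\mathcal Y=\mathcal Y^*=\mathbb R^{n\times d}$ with Frobenius inner product and norm; $B=[b_1,\dots,b_n]$ with $b_i\in\mathbb R^d$ (not to be confused with the mini-batch sizes below, which are also written $b_k$). $f_i:\mathcal X\to\mathbb R$ and $D_i:\mathcal X\to\mathbb R^d$ ($i=1,\dots,n$) are continuously differentiable, $\gamma>0$, $F_i(x,B)=F_i(x,b_i)=f_i(x)+\frac{\gamma}{2}\|D_i(x)-b_i\|^2$ and $F(x,B)=\frac1n\sum_{i=1}^nF_i(x,b_i)$. $h:\mathbb R^d\to(-\infty,+\infty]$ is a lower semicontinuous proper function (proper: nonempty domain and $\inf h>-\infty$), a W-type regularizer, the model case being $h(z)=\lambda\sum_j||z_j|-1|$ with $\lambda>0$; $h(B)=\sum_ih(b_i)$; $J(x,B)=F(x,B)+h(B)$. $h^*(\Lambda)=\sup_{Y}\{\langle\Lambda,Y\rangle-h(Y)\}$ is the conjugate. The Lagrangian is $\mathcal L(x,B,\Lambda)=F(x,B)+\langle B,\Lambda\rangle-h^*(\Lambda)$, and $\partial\mathcal L(x,B,\Lambda)=\{\nabla_xF(x,B)\}\times\{\nabla_BF(x,B)+\Lambda\}\times(B-\partial h^*(\Lambda))$. $\mathrm{dist}$ is Euclidean distance to a set. The set of critical points $\{(x,B,\Lambda):0\in\partial\mathcal L(x,B,\Lambda)\}$ is assumed nonempty. Assumption 1. (i) The generated sequence $\{(x^k,B^k,\Lambda^k)\}$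 is bounded and $J$ is bounded below by $J^*$. (iii) For $i$ uniform on $\{1,\dots,n\}$ and any $B$, there is a constant $\sigma^2\ge0$ such that $\mathbb E_i[\nabla_xF_i(x,b_i)]=\nabla_xF(x,B)$ and $\mathbb E_i\|\nabla_xF_i(x,b_i)-\nabla_xF(x,B)\|^2\le\sigma^2$. Assumption 2. There is $L_F>0$ such that for $i$ uniform on $\{1,\dots,n\}$ and all $x,x'\in\mathcal X$, $B,B'\in\mathcal B$: $\mathbb E_i\|\nabla F_i(x,B)-\nabla F_i(x',B')\|^2\le L_F^2(\|x-x'\|^2+\|B-B'\|^2)$. DualHash-StoRM. Initialize $x^1\in\mathcal X$, $B^1\in\mathcal B$, $\Lambda^1\in\mathcal Y^*$, with parameters $\eta_k$, $\tau$, $b_k$, $\rho_k\in(0,1)$. At iteration $k\ge1$ a mini-batch $\mathcal J_k\subseteq\{1,\dots,n\}$ of size $b_k$ is sampled uniformly, $\nabla_xF(x,B;\mathcal J_k)=\frac1{b_k}\sum_{j\in\mathcal J_k}\nabla_xF_j(x,b_j)$, and $D^1=\nabla_xF(x^1,B^1;\mathcal J_1)$; for $k>1$, $D^k=\nabla_xF(x^k,B^k;\mathcal J_k)+(1-\rho_{k-1})\big(D^{k-1}-\nabla_xF(x^{k-1},B^{k-1};\mathcal J_k)\big)$; $x^{k+1}=x^k-\eta_kD^k$, $B^{k+1}=B^k-\tau(\nabla_BF(x^{k+1},B^k)+\Lambda^k)$, $\Lambda^{k+1}=\arg\min_\Lambda\{h^*(\Lambda)-\langle\Lambda,2B^{k+1}-B^k\rangle+\frac\tau2\|\Lambda-\Lambda^k\|^2\}$.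 Lyapunov function. $\Delta_x^k=\frac12\|x^k-x^{k-1}\|^2$, $\Delta_B^k=\frac12\|B^k-B^{k-1}\|^2$, $\Psi^k_{\rm storm}=\mathcal L(x^k,B^k,\Lambda^k)-C_1\Delta_B^{k+1}+C_2\Delta_B^k-C_3\Delta_x^{k+1}$, with $K_1=3\delta\tau^{-1}$, $K_2=2\tau^{-1}-L_F-3\delta\tau(\tau^{-1}+L_F)^2$, $K_3=\tau L_F^2/\delta$, $K_4=3\delta\tau L_F^2$, $C_1=K_1$, $C_2=\frac12(K_2-K_1+K_3)$, $C_3=K_4$. $\Psi^*_{\rm storm}$ is a lower bound of $\Psi^k_{\rm storm}$. (The term $\Delta_B^1$ in $\Psi^1_{\rm storm}$ refers to an index-0 point $B^0$, about which nothing is prescribed.) SFO: one call is one evaluation of some $\nabla_xF_j$; the count is, up to a constant factor, the sum of the mini-batch sizes. The $\mathcal O(\cdot)$ is as $\varepsilon\to0$ with the other constants fixed.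
   Formalization: The index-0 point B^0 in Ψ^1 is required to be a genuine earlier iterate: for some Λ^0 the B- and Λ-updates from (B^0,Λ^0) yield (B^1,Λ^1). With B^0 unprescribed (even B^0=B^1) the claim is false, e.g. n=d=1, F=b²/2, h(z)=||z|-1|, B^0=B^1=0, Λ^1=1. *)

(* Defs.v *)
From HB Require Import structures.
From mathcomp Require Import all_boot all_order all_algebra.
From mathcomp Require Import all_classical all_reals all_analysis.
Set Implicit Arguments.
Unset Strict Implicit.
Unset Printing Implicit Defensive.
Import Order.TTheory GRing.Theory Num.Theory.
Import numFieldNormedType.Exports.

Local Open Scope classical_set_scope.
Local Open Scope ring_scope.

Section Generic.
Context {R : realType}.

Definition frob {m d : nat} (A B : 'M[R]_(m, d)) : R :=
  \sum_i \sum_j A i j * B i j.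

(* Squared Frobenius norm; the library norm [`|A|] of a matrix is the sup norm,
   which defines the same topology and the same differentials. *)
Definition frob2 {m d : nat} (A : 'M[R]_(m, d)) : R := frob A A.

Definition finite_dim (V : lmodType R) : Prop :=
  exists (m : nat) (e : 'I_m -> V),
    forall v, exists c : 'I_m -> R, v = \sum_i c i *: e i.

(* Riesz representative of the Frechet differential for the inner product
   [dot]; it is unique, and exists on finite-dimensional spaces. *)
Definition grad {V : normedModType R} (dot : V -> V -> R) (phi : V -> R^o)
    (v : V) : V :=
  xget 0 [set g | forall u, 'd phi v u = dot g u].

(* On a finite-dimensional space, pointwise continuity of [y |-> 'd phi y u] in
   every direction [u] is continuity of the differential in operator norm. *)
Definition C1 {V W : normedModType R} (phi : V -> W) : Prop :=
  (forall v, differentiable phi v) /\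
  (forall u, continuous (fun v => 'd phi v u : W)).

Definition is_argmin {T : Type} (phi : T -> \bar R) (t : T) : Prop :=
  forall s, (phi t <= phi s)%E.

Definition mean {n : nat} {V : lmodType R} (v : 'I_n -> V) : V :=
  n%:R^-1 *: \sum_i v i.

Definition subdiff {m d : nat} (G : 'M[R]_(m, d) -> \bar R) (A : 'M[R]_(m, d)) :
    set 'M[R]_(m, d) :=
  [set xi | G A \is a fin_num /\
    forall A', (G A + (frob xi (A' - A))%:E <= G A')%E].

End Generic.

Record problem (R : realType) (X : normedModType R) (n d : nat) := Problem {
  dotX : {dot X for idfun};
  fun_f : 'I_n -> X -> R^o;
  fun_D : 'I_n -> X -> 'rV[R]_d;
  gam : R;
  reg : 'rV[R]_d -> \bar R
}.

Section Problem.
Context {R : realType} {X : normedModType R} {n d : nat}.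
Variable p : problem X n d.
Local Notation MB := 'M[R]_(n, d).

Definition Fi (i : 'I_n) (x : X) (b : 'rV[R]_d) : R^o :=
  fun_f p i x + gam p / 2 * frob2 (fun_D p i x - b).

Definition F (x : X) (B : MB) : R^o := mean (fun i => Fi i x (row i B)).

Definition regM (B : MB) : \bar R := (\sum_i reg p (row i B))%E.

Definition regconj (L : MB) : \bar R :=
  ereal_sup [set ((frob L Y)%:E - regM Y)%E | Y in [set: MB]].

Definition J (x : X) (B : MB) : \bar R := ((F x B)%:E + regM B)%E.

Definition Lag (x : X) (B L : MB) : \bar R :=
  ((F x B + frob B L)%:E - regconj L)%E.

Definition gradx_Fi (i : 'I_n) (x : X) (b : 'rV[R]_d) : X :=
  grad (dotX p) (fun y => Fi i y b) x.

(* Gradient of [F_i] in the whole matrix [B], although [F_i] only involves its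
   [i]-th row; with [gradx_Fi] it makes up the full gradient of [F_i]. *)
Definition gradB_Fi (i : 'I_n) (x : X) (B : MB) : MB :=
  grad frob (fun C : MB => Fi i x (row i C)) B.

Definition gradx_F (x : X) (B : MB) : X := grad (dotX p) (fun y => F y B) x.

Definition gradB_F (x : X) (B : MB) : MB := grad frob (F x) B.

Definition partial_Lag (x : X) (B L : MB) : set (X * MB * MB) :=
  [set gradx_F x B] `*` [set gradB_F x B + L]
    `*` [set B - xi | xi in subdiff regconj L].

(* Euclidean distance to the origin; [+oo] for the empty set. *)
Definition dist0 (A : set (X * MB * MB)) : \bar R :=
  ereal_inf
    [set (Num.sqrt (`|v.1.1| ^+ 2 + frob2 v.1.2 + frob2 v.2))%:E | v in A].

(* The third field makes the norm of [X] the Hilbert norm of [dotX p]. *)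
Record standing : Prop := {
  std_n : (0 < n)%N;
  std_gam : 0 < gam p;
  std_norm : forall x : X, `|x| ^+ 2 = dotX p x x;
  std_dim : finite_dim X;
  std_f : forall i, C1 (fun_f p i);
  std_D : forall i, C1 (fun_D p i);
  std_lsc : lower_semicontinuous (reg p);
  std_dom : exists z, (reg p z < +oo)%E;
  std_inf : exists c : R, forall z, (c%:E <= reg p z)%E;
  std_crit : exists x B L, partial_Lag x B L (0, 0, 0)
}.

Definition bounded_below_J : Prop :=
  exists Jstar : R, forall x B, (Jstar%:E <= J x B)%E.

Definition bounded_iterates (x : nat -> X) (B L : nat -> MB) : Prop :=
  exists M : R, forall k, (1 <= k)%N ->
    [/\ `|x k| <= M, `|B k| <= M & `|L k| <= M].

Definition unbiased_bounded_variance (sigma2 : R) : Prop :=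
  0 <= sigma2 /\ forall x B,
    mean (fun i => gradx_Fi i x (row i B)) = gradx_F x B /\
    mean (fun i => `|gradx_Fi i x (row i B) - gradx_F x B| ^+ 2 : R^o)
      <= sigma2.

Definition mean_square_smooth (LF : R) : Prop :=
  0 < LF /\ forall x x' B B',
    mean (fun i => `|gradx_Fi i x (row i B) - gradx_Fi i x' (row i B')| ^+ 2
                   + frob2 (gradB_Fi i x B - gradB_Fi i x' B') : R^o)
      <= LF ^+ 2 * (`|x - x'| ^+ 2 + frob2 (B - B')).

Definition batch_grad (S : {set 'I_n}) (x : X) (B : MB) : X :=
  #|S|%:R^-1 *: \sum_(j in S) gradx_Fi j x (row j B).

Definition B_update (tau : R) (x' : X) (B L B' : MB) : Prop :=
  B' = B - tau *: (gradB_F x' B + L).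

Definition L_update (tau : R) (B B' L L' : MB) : Prop :=
  is_argmin (fun M : MB =>
    (regconj M - (frob M (2 *: B' - B))%:E
      + (tau / 2 * frob2 (M - L))%:E)%E) L'.

(* A sample path driven by the mini-batches [S]; iterations start at index 1. *)
Record DualHash_StoRM (eta_ rho_ : nat -> R) (tau : R) (S : nat -> {set 'I_n})
    (x1 : X) (B1 L1 : MB) (x D : nat -> X) (B L : nat -> MB) : Prop := {
  alg_rho : forall k, (1 <= k)%N -> 0 < rho_ k < 1;
  alg_x1 : x 1%N = x1;
  alg_B1 : B 1%N = B1;
  alg_L1 : L 1%N = L1;
  alg_D1 : D 1%N = batch_grad (S 1%N) (x 1%N) (B 1%N);
  alg_D : forall k, (1 <= k)%N ->
    D k.+1 = batch_grad (S k.+1) (x k.+1) (B k.+1)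
      + (1 - rho_ k) *: (D k - batch_grad (S k.+1) (x k) (B k));
  alg_x : forall k, (1 <= k)%N -> x k.+1 = x k - eta_ k *: D k;
  alg_B : forall k, (1 <= k)%N -> B_update tau (x k.+1) (B k) (L k) (B k.+1);
  alg_L : forall k, (1 <= k)%N -> L_update tau (B k) (B k.+1) (L k) (L k.+1)
}.

(* [B0] is an index-0 iterate for the initialization [(x1, B1, L1)]: the [B]-
   and [L]-updates also hold at index 0, for some [L0].  Such a [B0] exists
   whenever the subdifferential of [regconj] at [L1] is nonempty.  For an
   unrelated [B0] the Lyapunov function may increase at the first iteration by
   an amount that its initial gap does not control. *)
Definition index0_point (tau : R) (x1 : X) (B0 B1 L1 : MB) : Prop :=
  exists L0 : MB, B_update tau x1 B0 L0 B1 /\ L_update tau B0 B1 L0 L1.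

Definition K1 (tau delta : R) : R := 3 * delta / tau.
Definition K2 (LF tau delta : R) : R :=
  2 / tau - LF - 3 * delta * tau * (tau^-1 + LF) ^+ 2.
Definition K3 (LF tau delta : R) : R := tau * LF ^+ 2 / delta.
Definition K4 (LF tau delta : R) : R := 3 * delta * tau * LF ^+ 2.

Definition Delta_x (x : nat -> X) (k : nat) : R := `|x k - x k.-1| ^+ 2 / 2.
Definition Delta_B (B : nat -> MB) (k : nat) : R := frob2 (B k - B k.-1) / 2.

Definition Psi (LF tau delta : R) (x : nat -> X) (B L : nat -> MB) (k : nat) :
    \bar R :=
  let C1 := K1 tau delta in
  let C2 := (K2 LF tau delta - K1 tau delta + K3 LF tau delta) / 2 in
  let C3 := K4 LF tau delta in
  (Lag (x k) (B k) (L k)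
    + (- C1 * Delta_B B k.+1 + C2 * Delta_B B k - C3 * Delta_x x k.+1)%:E)%E.

End Problem.

Section Schedule.
Context {R : realType}.

Definition Ltilde (LF tau delta : R) : R :=
  LF + tau * LF ^+ 2 / delta + 3 * delta * tau * LF ^+ 2.

Definition step_size (LF tau delta eta : R) (T k : nat) : R :=
  eta / (Ltilde LF tau delta * T%:R `^ (3^-1)).

Definition momentum (eta rho : R) (T k : nat) : R :=
  8 * rho * eta ^+ 2 / T%:R `^ (2 / 3).

(* [c_b T^(1/3)] is rounded up, and a batch larger than the index set (which has
   only [n] elements) is taken to be the whole index set. *)
Definition batch_size (n : nat) (cb : R) (b T k : nat) : nat :=
  minn n (if k == 1%N then `|Num.ceil (cb * T%:R `^ (3^-1))|%N else b).

(* One evaluation per batch element at the first iteration, two at the others. *)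
Definition sfo_calls (bs : nat -> nat) (T : nat) : nat :=
  \sum_(1 <= k < T.+1) (if k == 1%N then bs k else 2 * bs k).

End Schedule.

(* The batches [S k], [k >= 1], are uniform on the subsets of size [bs k], the
   index [r] is uniform on [{2, ..., T+1}], and all of them are independent
   (stated on atoms, for every initial segment of batches). *)
Record uniform_sampling {R : realType} {disp : measure_display}
    {Omega : measurableType disp} (P : probability Omega R) {n : nat}
    (bs : nat -> nat) (T : nat) (S : nat -> Omega -> {set 'I_n})
    (r : Omega -> nat) : Prop := {
  smp_S_meas : forall k (A : {set 'I_n}), (1 <= k)%N ->
    measurable [set w | S k w = A];
  smp_r_meas : forall m, measurable [set w | r w = m];
  smp_S_unif : forall k (A : {set 'I_n}), (1 <= k)%N ->
    P [set w | S k w = A] =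
      (if #|A| == bs k then ('C(n, bs k)%:R^-1 : R) else 0)%:E;
  smp_r_unif : forall m,
    P [set w | r w = m] =
      (if (2 <= m <= T.+1)%N then (T%:R^-1 : R) else 0)%:E;
  smp_indep : forall N (A : nat -> {set 'I_n}) m,
    P [set w | (forall k, (1 <= k <= N)%N -> S k w = A k) /\ r w = m] =
      (\prod_(1 <= k < N.+1) P [set w | S k w = A k] * P [set w | r w = m])%E
}.

(* Main.v *)
Require Import Defs.
From HB Require Import structures.
From mathcomp Require Import all_boot all_order all_algebra.
From mathcomp Require Import all_classical all_reals all_analysis.
From mathcomp Require Import measurable_realfun perm ring lra zify.
Import Order.TTheory GRing.Theory Num.Theory.
Import numFieldNormedType.Exports.
Set Implicit Arguments.
Unset Strict Implicit.
Unset Printing Implicit Defensive.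
Local Open Scope classical_set_scope.
Local Open Scope ring_scope.

(** The variance bound is uniform in [B], while [gradx_Fi i x b] is affine in [b];
    with at least two components this forces [gradx_Fi i x b] not to depend on [b],
    and with one component there is no sampling noise.  Hence the momentum error
    [err k = D k - gradx_F (x k) (B k)] obeys
      [E |err k.+1|^2 <= (1 - a)^2 E |err k|^2 + 2 a^2 sigma2 / b + 2 LF^2 h^2 E |D k|^2],
    with no term in [B k.+1 - B k].  Such a term, divided by the momentum
    [a ~ T^(-2/3)], could not be absorbed by the descent, because [tau] does not
    shrink with [T].

    Along every path, [xi k = B k.+1 + tau (g k.+1 - g k)] with
    [g k = gradB_F (x k) (B k.-1)] is a subgradient of the conjugate at [L k].  Using
    it in the convexity inequality at [L k] makes the Lyapunov function decrease up to
    [h / 2 * |err k|^2], and also bounds the distance of the subdifferential of the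
    Lagrangian to 0.  Averaging over the finitely many batch histories and summing
    over [k] gives the rate. *)

(** * Inner products *)

(** No measurability of the iterates is assumed, so conditional expectations are avoided. The
    quadratic term of the [L]-update makes its minimizer unique, hence iterates are determined by
    the batches drawn before them. Everything that enters the rate therefore depends on finitely
    many batches, and integrals become finite sums over batch histories, evaluated at one chosen
    sample point per history; averaging one batch with the others fixed replaces conditioning. As
    the lower bound on [Psi] holds only almost everywhere, these points are chosen where it holds,
    which is possible for every history of positive weight. The initial gap depends on [T] through
    the second iterate, but only by nonpositive terms. A bound on it that is free of [T] is what
    turns the formula for [T] into an order [eps^-3]. *)

Lemma mean_realE {R : realType} {n : nat} (f : 'I_n -> R^o) :
  mean f = n%:R^-1 * \sum_i f i.
Proof. by []. Qed.

Record inner_product {R : realType} {V : lmodType R} (ip : V -> V -> R) : Prop := {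
  ip_sym : forall u v, ip u v = ip v u;
  ip_linl : forall a u v w, ip (a *: u + v) w = a * ip u w + ip v w;
  ip_ge0 : forall u, 0 <= ip u u;
  ip_eq0 : forall u, ip u u = 0 -> u = 0 }.

Section InnerProduct.
Context {R : realType} {V : lmodType R} {ip : V -> V -> R}.
Hypothesis H : inner_product ip.
Implicit Types u v w : V.

Lemma ipDl u v w : ip (u + v) w = ip u w + ip v w.
Proof. by rewrite -[u in LHS]scale1r (ip_linl H) mul1r. Qed.

Lemma ip0l w : ip 0 w = 0.
Proof. by apply: (addrI (ip 0 w)); rewrite -ipDl !addr0. Qed.

Lemma ipZl a u w : ip (a *: u) w = a * ip u w.
Proof. by rewrite -[a *: u]addr0 (ip_linl H) ip0l addr0. Qed.

Lemma ipNl u w : ip (- u) w = - ip u w.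
Proof. by rewrite -scaleN1r ipZl mulN1r. Qed.

Lemma ipBl u v w : ip (u - v) w = ip u w - ip v w.
Proof. by rewrite ipDl ipNl. Qed.

Lemma ipDr u v w : ip u (v + w) = ip u v + ip u w.
Proof. by rewrite ip_sym // ipDl !(ip_sym H _ u). Qed.

Lemma ipZr a u w : ip u (a *: w) = a * ip u w.
Proof. by rewrite ip_sym // ipZl (ip_sym H). Qed.

Lemma ipNr u w : ip u (- w) = - ip u w.
Proof. by rewrite ip_sym // ipNl (ip_sym H). Qed.

Lemma ipBr u v w : ip u (v - w) = ip u v - ip u w.
Proof. by rewrite ipDr ipNr. Qed.

Lemma ip0r w : ip w 0 = 0.
Proof. by rewrite ip_sym // ip0l. Qed.

Definition ipE := (ipDl, ipDr, ipNl, ipNr, ipZl, ipZr, ip0l, ip0r).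

Lemma ip_suml (I : Type) (r : seq I) (P : pred I) (f : I -> V) w :
  ip (\sum_(i <- r | P i) f i) w = \sum_(i <- r | P i) ip (f i) w.
Proof.
apply: (big_ind2 (fun a b => ip a w = b)) => //; first exact: ip0l.
by move=> a _ b _ <- <-; rewrite ipDl.
Qed.

Lemma ip_sumr (I : Type) (r : seq I) (P : pred I) (f : I -> V) w :
  ip w (\sum_(i <- r | P i) f i) = \sum_(i <- r | P i) ip w (f i).
Proof. by rewrite ip_sym // ip_suml; apply: eq_bigr => i _; rewrite ip_sym. Qed.

Lemma ip_sqD_le2 u v : ip (u + v) (u + v) <= 2 * ip u u + 2 * ip v v.
Proof.
have := ip_ge0 H (u - v); rewrite !ipE (ip_sym H v u); lra.
Qed.

Lemma ip_sqD_le3 u v w :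
  ip (u + v + w) (u + v + w) <= 3 * ip u u + 3 * ip v v + 3 * ip w w.
Proof.
have := ip_ge0 H (u - v); have := ip_ge0 H (u - w); have := ip_ge0 H (v - w).
rewrite !ipE (ip_sym H v u) (ip_sym H w u) (ip_sym H w v); lra.
Qed.

Lemma ip_young c u v : 0 < c -> ip u v <= c / 2 * ip u u + (2 * c)^-1 * ip v v.
Proof.
move=> c0; have := ip_ge0 H (c *: u - v); rewrite !ipE (ip_sym H v u) => h.
have -> : c / 2 * ip u u + (2 * c)^-1 * ip v v =
  (2 * c)^-1 * (c ^+ 2 * ip u u + ip v v) by field; rewrite gt_eqF.
rewrite mulrC ler_pdivlMr ?mulr_gt0 //; lra.
Qed.

(** Cauchy-Schwarz without square roots: expand the square of [u - c *: v] and divide by [2 c]; for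
    [c = 0] the hypothesis forces [u = 0]. *)
Lemma ip_le_of_sq c u v : 0 <= c -> ip u u <= c ^+ 2 * ip v v ->
  ip u v <= c * ip v v.
Proof.
rewrite le_eqVlt => /predU1P[<-|c0] h.
  have /(ip_eq0 H) -> : ip u u = 0.
    by apply/eqP; rewrite eq_le (ip_ge0 H) andbT (le_trans h) // expr0n mul0r.
  by rewrite ip0l mul0r.
have := ip_ge0 H (u - c *: v); rewrite !ipE (ip_sym H v u) => h'.
rewrite -(ler_pM2l c0); lra.
Qed.

Lemma ip_sqD u v : ip (u + v) (u + v) = ip u u + 2 * ip u v + ip v v.
Proof. by rewrite !ipE (ip_sym H v u); ring. Qed.

Lemma ip_sqB u v : ip (u - v) (u - v) = ip u u - 2 * ip u v + ip v v.
Proof. by rewrite !ipE (ip_sym H v u); ring. Qed.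

(** The variance identity. Dropping its left side gives Jensen's inequality for the square, and
    dropping the subtracted term bounds a variance by the second moment. *)
Lemma sum_ip_centered (n : nat) (v : 'I_n -> V) : (0 < n)%N ->
  \sum_i ip (v i - mean v) (v i - mean v) =
  \sum_i ip (v i) (v i) - n%:R * ip (mean v) (mean v).
Proof.
move=> n0; have nn : n%:R != 0 :> R by rewrite pnatr_eq0 -lt0n.
have sE : \sum_i v i = n%:R *: mean v by rewrite /mean scalerA divff // scale1r.
under eq_bigr do rewrite ip_sqB.
rewrite !big_split /= sumrN -mulr_sumr -ip_suml sE ipZl sumr_const card_ord -mulr_natl; ring.
Qed.

Lemma ip_mean_le (n : nat) (v : 'I_n -> V) :
  ip (mean v) (mean v) <= mean (fun i => ip (v i) (v i) : R^o).
Proof.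
case: n v => [v|n v].
  by rewrite /mean !big_ord0 !scaler0 ip0l.
have := @sum_ip_centered n.+1 v isT; rewrite mean_realE => e.
rewrite mulrC ler_pdivlMr ?ltr0n // mulrC -subr_ge0 -e.
by apply: sumr_ge0 => i _; exact: ip_ge0.
Qed.

Lemma mean_centered_le (n : nat) (v : 'I_n -> V) :
  mean (fun i => ip (v i - mean v) (v i - mean v) : R^o) <=
  mean (fun i => ip (v i) (v i) : R^o).
Proof.
case: n v => [v|n v]; first by rewrite /mean !big_ord0.
rewrite !mean_realE ler_wpM2l ?invr_ge0 ?ler0n // sum_ip_centered //.
by rewrite lerBlDr lerDl mulr_ge0 ?ler0n ?ip_ge0.
Qed.

Let scalar_fun (l : V -> R) := forall a u v, l (a *: u + v) = a * l u + l v.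

(* Gram-Schmidt on the generators: only the component [s] of [e m] orthogonal to
   its predecessors has to be added.  Membership of [g] in their span is expressed
   dually, by the vanishing at [g] of every functional that vanishes on them. *)
Lemma riesz_span (e : nat -> V) (m : nat) (l : V -> R) : scalar_fun l ->
  exists g : V, (forall k, scalar_fun k ->
      (forall i, (i < m)%N -> k (e i) = 0) -> k g = 0) /\
    forall i, (i < m)%N -> l (e i) = ip g (e i).
Proof.
have ip_scalar u : scalar_fun (ip u) by move=> a v w; rewrite !ipE.
have scalarB k k' : scalar_fun k -> scalar_fun k' ->
    scalar_fun (fun u => k u - k' u).
  by move=> kl kl' a u v; rewrite kl kl'; ring.
have scalarD k : scalar_fun k -> forall u v, k (u + v) = k u + k v.
  by move=> kl u v; rewrite -[u in LHS]scale1r kl mul1r.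
have scalar0 k : scalar_fun k -> k 0 = 0.
  by move=> kl; apply: (addrI (k 0)); rewrite -scalarD // !addr0.
elim: m l => [|m IH] l ll.
  by exists 0; split => // k kl _; exact: scalar0.
have [g [gS gP]] := IH l ll.
(* The induction hypothesis for the functional [ip (e m)] yields [p], the orthogonal projection of
   [e m] on the span of its predecessors. *)
have [p [pS pP]] := IH (ip (e m)) (ip_scalar _).
have [s sE] : exists s, s = e m - p by exists (e m - p).
pose t := (l (e m) - ip g (e m)) / ip s s.
have s_orth i : (i < m)%N -> ip s (e i) = 0.
  by move=> im; rewrite sE ipBl pP // subrr.
have sp0 : ip s p = 0 by exact: pS.
have sm : ip s (e m) = ip s s by rewrite [in X in _ = ip _ X]sE ipBr sp0 subr0.
exists (g + t *: s); split.
  move=> k kl k0; have km i : (i < m)%N -> k (e i) = 0.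
    by move=> im; apply: k0; rewrite ltnS ltnW.
  have ks : k s = 0.
    have := scalarD _ kl s p; rewrite [in s + p]sE subrK (pS _ kl km) k0 // addr0 => <-//.
  by rewrite addrC kl ks (gS _ kl km) mulr0 addr0.
move=> i; rewrite ltnS leq_eqVlt => /predU1P[->|im]; last first.
  by rewrite gP // !ipE s_orth // mulr0 addr0.
(* When [s] vanishes, [e m] is in the span of its predecessors, where [l] and [ip g] already
   agree. *)
rewrite !ipE sm; have [s0|s0] := eqVneq (ip s s) 0; last by rewrite /t divfK //; ring.
have -> : e m = p by apply/eqP; rewrite -subr_eq0 -sE; apply/eqP; exact: (ip_eq0 H).
rewrite s0 mulr0 addr0; apply/eqP; rewrite -subr_eq0; apply/eqP.
apply: (pS (fun u => l u - ip g u)) => [|j jm]; first exact: scalarB.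
by rewrite gP // subrr.
Qed.

Lemma riesz (l : V -> R) : finite_dim V ->
  (forall a u v, l (a *: u + v) = a * l u + l v) ->
  exists g, forall u, l u = ip g u.
Proof.
move=> [m [e eP]] ll.
pose e' i := if insub i is Some j then e j else 0.
have e'E (j : 'I_m) : e' j = e j by rewrite /e' valK.
have [g [_ gP]] := riesz_span e' m ll; exists g => u.
have lD v w : l (v + w) = l v + l w by rewrite -[v in LHS]scale1r ll mul1r.
have l0 : l 0 = 0 by apply: (addrI (l 0)); rewrite -lD !addr0.
have [c ->] := eP u; rewrite ip_sumr.
apply: (big_ind2 (fun v a => l v = a)) => // [v _ w _ <- <-//|i _].
by rewrite ipZr -e'E -gP // -[_ *: _]addr0 ll l0 addr0.
Qed.
End InnerProduct.

(** * Gradients *)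

Section Frobenius.
Context {R : realType}.

Lemma frob_inner_product (m d : nat) : inner_product (@frob R m d).
Proof.
split=> [A B|a A B C|A|A].
- by apply: eq_bigr => i _; apply: eq_bigr => j _; rewrite mulrC.
- rewrite /frob mulr_sumr -big_split; apply: eq_bigr => i _.
  by rewrite mulr_sumr -big_split; apply: eq_bigr => j _; rewrite !mxE mulrDl mulrA.
- by apply: sumr_ge0 => i _; apply: sumr_ge0 => j _; rewrite -expr2 sqr_ge0.
- move=> A0; apply/matrixP => i j; rewrite mxE.
  have sq k l : 0 <= A k l * A k l by rewrite -expr2 sqr_ge0.
  have /(_ i isT) /psumr_eq0P := psumr_eq0P (fun k _ => sumr_ge0 _ (fun l _ => sq k l)) A0.
  by move=> /(_ (fun l _ => sq i l) j isT) /eqP; rewrite mulf_eq0 orbb => /eqP.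
Qed.

Lemma matrix_finite_dim (m d : nat) : finite_dim 'M[R]_(m, d).
Proof.
pose T := ('I_m * 'I_d)%type.
exists #|{: T}|, (fun k => delta_mx (enum_val k).1 (enum_val k).2) => A.
exists (fun k => A (enum_val k).1 (enum_val k).2).
rewrite {1}[A]matrix_sum_delta pair_big /= (reindex (@enum_val T predT)) //=.
by apply: onW_bij; exact: enum_val_bij.
Qed.
End Frobenius.

Section Gradient.
Context {R : realType} {V : normedModType R} {ip : V -> V -> R}.
Hypothesis H : inner_product ip.

Lemma gradP (phi : V -> R^o) v : finite_dim V ->
  forall u, 'd phi v u = ip (grad ip phi v) u.
Proof.
move=> fd; have [g gP] := riesz H fd (linearP ('d phi v)).
exact: (@xgetPex V 0 [set g | forall u, 'd phi v u = ip g u] (ex_intro _ g gP)).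
Qed.

Lemma grad_unique (phi : V -> R^o) v g : finite_dim V ->
  (forall u, 'd phi v u = ip g u) -> grad ip phi v = g.
Proof.
move=> fd gP; apply/eqP; rewrite -subr_eq0; apply/eqP/(ip_eq0 H).
by rewrite (ipBl H) -gradP // gP subrr.
Qed.

Lemma derive_grad (phi : V -> R^o) v u : finite_dim V -> differentiable phi v ->
  'D_u phi v = ip (grad ip phi v) u.
Proof. by move=> fd dphi; rewrite deriveE // gradP. Qed.

Lemma is_derive_line (phi : V -> R^o) (v u : V) (t : R) :
  (forall w, differentiable phi w) ->
  is_derive t (1 : R) (fun s : R => phi (v + s *: u)) ('d phi (v + t *: u) u).
Proof.
move=> dphi.
have dline : is_diff t (fun s : R => v + s *: u) ( *:%R^~ u).
  have : is_diff t (cst v + *:%R^~ u) (0 + *:%R^~ u) by apply: is_diffD.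
  by rewrite add0r.
have dphit : is_diff ((fun s : R => v + s *: u) t) phi ('d phi (v + t *: u)).
  by apply: DiffDef => //; exact: dphi.
have dc : is_diff t (phi \o (fun s : R => v + s *: u))
    ('d phi (v + t *: u) \o *:%R^~ u) by apply: is_diff_comp.
apply: DeriveDef.
  by apply: diff_derivable; exact: ex_diff.
by rewrite deriveE ?diff_val /= ?scale1r //; exact: ex_diff.
Qed.

(** The mean value theorem on [0, 1] replaces integration: subtract from [phi (v + s *: u)] its
    linear part and [s^2 * M / 2 * ip u u]. The derivative of the remainder is nonpositive, by the
    Lipschitz bound at distance [s] and [ip_le_of_sq] with constant [s * M]. *)
Lemma descent_of_lipschitz (phi : V -> R^o) (v u : V) (M : R) : finite_dim V ->
  (forall w, differentiable phi w) -> 0 <= M ->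
  (forall w w', let g := grad ip phi w - grad ip phi w' in
     ip g g <= M ^+ 2 * ip (w - w') (w - w')) ->
  phi (v + u) <= phi v + ip (grad ip phi v) u + M / 2 * ip u u.
Proof.
move=> fd dphi M0 lip.
pose psi (s : R) : R := phi (v + s *: u) - s * ip (grad ip phi v) u
   - s ^+ 2 * (M / 2 * ip u u).
pose dpsi (s : R) : R := ip (grad ip phi (v + s *: u) - grad ip phi v) u
   - s * (M * ip u u).
have psiD (s : R) : is_derive s (1 : R) psi (dpsi s).
  have d1 := is_derive_line v u s dphi.
  rewrite /psi; apply: is_derive_eq.
  rewrite /dpsi (gradP _ _ fd) (ipBl H) /GRing.scale /=; lra.
have [|s /[!in_itv]/= /andP[s0 s1]] := @MVT R psi dpsi 0 1 ltr01 (fun s _ => psiD s).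
  apply: derivable_within_continuous => s _.
  by have [] := psiD s.
rewrite subr0 mulr1 /psi scale1r scale0r addr0 => e.
have : dpsi s <= 0.
  rewrite /dpsi subr_le0 mulrA; apply: (ip_le_of_sq H); first by rewrite mulr_ge0 // ltW.
  apply: le_trans (lip _ _) _.
  by rewrite addrC addKr (ipZl H) (ipZr H) exprMn; lra.
rewrite -e; lra.
Qed.
End Gradient.

(** * The component functions *)

Lemma ip_bounded_line {R : realType} {V : lmodType R} {ip : V -> V -> R}
    (H : inner_product ip) (K : R) (a c : V) :
  (forall t, ip (a + t *: c) (a + t *: c) <= K) -> c = 0.
Proof.
move=> bnd; apply: (ip_eq0 H); apply/eqP; case: eqVneq => // cn0; exfalso.
have c0 : 0 < ip c c by rewrite lt_neqAle eq_sym cn0 (ip_ge0 H).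
have a1 := bnd 0; rewrite scale0r addr0 in a1.
have K0 : 0 <= K by apply: le_trans a1; exact: ip_ge0.
have tbnd t : t ^+ 2 * ip c c <= 4 * K.
  have := ip_sqD_le2 H (a + t *: c) (- a); have := bnd t.
  rewrite (addrC (a + t *: c) (- a)) addKr (ipNl H) (ipNr H) opprK (ipZl H) (ipZr H); lra.
(* At [t = s + 1] the bound [t^2 <= s] fails, since [(s + 1)^2 > s]. *)
pose s := (4 * K) / ip c c; have s0 : 0 <= s by rewrite divr_ge0 ?mulr_ge0 // ltW.
have := tbnd (s + 1); have -> : 4 * K = s * ip c c by rewrite divfK ?gt_eqF.
rewrite ler_pM2r //; nra.
Qed.

Lemma sum_centered {R : realType} {V : lmodType R} {n : nat} (v : 'I_n -> V) :
  (0 < n)%N -> \sum_i (v i - mean v) = 0.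
Proof.
move=> n0; rewrite sumrB sumr_const card_ord /mean -scaler_nat scalerA.
by rewrite divff ?scale1r ?subrr // pnatr_eq0 -lt0n.
Qed.

(** Centering commutes with differences and does not increase the second moment. The family [w] is
    another expression of [u'], chosen so that the second moment of [u - w] is the one that can be
    bounded. *)
Lemma mean_centered_sub_le {R : realType} {V : lmodType R} {ip : V -> V -> R}
    (H : inner_product ip) (n : nat) (u u' w : 'I_n -> V) (K : R) :
  (forall k, u' k = w k) ->
  mean (fun i => ip (u i - w i) (u i - w i) : R^o) <= K ->
  mean (fun i => let v := (u i - mean u) - (u' i - mean u') in ip v v : R^o) <= K.
Proof.
move=> /funext ->; apply: le_trans.
have -> : (fun i => let v := (u i - mean u) - (w i - mean w) in ip v v : R^o) =
    fun i => let v := (u i - w i) - mean (fun k => u k - w k) in ip v v : R^o.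
  have mB : mean (fun k => u k - w k) = mean u - mean w.
    by rewrite /mean sumrB scalerBr.
  by apply/funext => i /=; rewrite mB !opprD !opprK addrACA.
exact: (mean_centered_le H (fun i => u i - w i)).
Qed.

(* The bound [K] is uniform in [B], whereas the deviation of [G i] from the mean
   is affine in the [i]-th row, with slope [1 - n^-1] times that of [G i]. *)
Lemma affine_bounded_const {R : realType} {V : lmodType R} {ip : V -> V -> R}
    (H : inner_product ip) (n d : nat) (G : 'I_n -> 'rV[R]_d -> V) (K : R) :
  (forall i b u t, G i (b + t *: u) = G i b + t *: (G i (b + u) - G i b)) ->
  (forall (B : 'M[R]_(n, d)) i,
     let v := G i (row i B) - mean (fun k => G k (row k B)) in ip v v <= K) ->
  (1 < n)%N -> forall i b b', G i b = G i b'.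
Proof.
move=> aff bnd n1 i b b'.
have [u ->] : exists u, b' = b + u by exists (b' - b); rewrite addrC subrK.
have [w wE] : exists w, w = G i (b + u) - G i b by eexists.
suff w0 : w = 0 by apply/esym/eqP; rewrite -subr_eq0 -wE w0.
have {}aff t : G i (b + t *: u) = G i b + t *: w by rewrite wE aff.
pose C t : 'M[R]_(n, d) := \matrix_(k, j) (if k == i then (b + t *: u) 0 j else 0).
have rowi t : row i (C t) = b + t *: u.
  by apply/rowP => j; rewrite !mxE eqxx.
have rowk t k : k != i -> row k (C t) = 0.
  by move=> ki; apply/rowP => j; rewrite !mxE (negbTE ki).
have [c cE] : exists c, forall t,
    mean (fun k => G k (row k (C t))) = c + (t / n%:R) *: w.
  exists (n%:R^-1 *: (G i b + \sum_(k | k != i) G k 0)) => t.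
  rewrite /mean (bigD1 i) //= rowi aff [t / _]mulrC -scalerA -scalerDr addrAC.
  by congr (_ *: (_ + _ + _)); apply: eq_bigr => k ki; rewrite rowk.
have /(ip_bounded_line H)/eqP : forall t,
    ip (G i b - c + t *: ((1 - n%:R^-1) *: w)) (G i b - c + t *: ((1 - n%:R^-1) *: w))
      <= K.
  move=> t; have := bnd (C t) i; rewrite /= cE rowi aff.
  suff -> : G i b + t *: w - (c + (t / n%:R) *: w) =
            G i b - c + t *: ((1 - n%:R^-1) *: w) by [].
  rewrite scalerA mulrBr mulr1 scalerBl opprD !addrA.
  by congr (_ - _); rewrite addrAC.
rewrite scaler_eq0 subr_eq0 => /orP[/eqP e|/eqP //].
have : n%:R = 1%:R :> R by rewrite -[n%:R]invrK -e invr1.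
by move/eqP; rewrite eqr_nat => /eqP e1; rewrite e1 in n1.
Qed.

Lemma differentiable_frob2 {R : realType} {V : normedModType R} {m d : nat}
    (g : V -> 'M[R]_(m, d)) (v : V) :
  (forall i j, differentiable (fun y => g y i j : R^o) v) ->
  differentiable (fun y => frob2 (g y) : R^o) v.
Proof.
move=> dg.
have -> : (fun y => frob2 (g y) : R^o) =
    \sum_i \sum_j (fun y => g y i j : R^o) * (fun y => g y i j : R^o).
  apply/funext => y; rewrite fct_sumE; apply: eq_bigr => i _.
  by rewrite fct_sumE.
apply: differentiable_sum => i; apply: differentiable_sum => j.
exact: differentiableM.
Qed.

Section ProblemGradients.
Context {R : realType} {X : normedModType R} {n d : nat}.
Variable p : problem X n d.
Hypothesis std : standing p.
Local Notation MB := 'M[R]_(n, d).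
Local Notation ip := (dotX p).
Local Notation gx i x b := (gradx_Fi p i x b).
Implicit Types (x : X) (B : MB).

Lemma dotX_inner_product : inner_product (dotX p).
Proof.
split=> [u v|a u v w|u|u].
- by rewrite hermC /= expr0 mul1r.
- by rewrite linearPl.
- by have [->|u0] := eqVneq u 0; [rewrite linear0l | rewrite ltW // neq0_dnorm_gt0].
- move=> u0; apply/eqP; case: eqVneq => // /(@neq0_dnorm_gt0 _ _ _ ip).
  by rewrite u0 ltxx.
Qed.
Let Hip := dotX_inner_product.
Let Hfr := @frob_inner_product R n d.
Let fdX := std_dim std.
Let fdM := @matrix_finite_dim R n d.

Lemma differentiable_Fi_x i b x : differentiable (fun y => Fi p i y b) x.
Proof.
have df : differentiable (fun_f p i) x := (std_f std i).1 x.
have dD : differentiable (fun_D p i) x := (std_D std i).1 x.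
rewrite /Fi; apply: differentiableD => //.
apply: (@differentiableZ _ _ _ (fun y => frob2 (fun_D p i y - b) : R^o)).
apply: differentiable_frob2 => k j.
have -> : (fun y => (fun_D p i y - b) k j : R^o) =
    ((fun A : 'rV[R]_d => A k j : R^o) \o fun_D p i) - cst (b k j).
  by apply/funext => y; rewrite !mxE.
apply: differentiableB => //; apply: differentiable_comp => //.
exact: differentiable_coord.
Qed.

Lemma differentiable_Fi_B i x B :
  differentiable (fun C : MB => Fi p i x (row i C) : R^o) B.
Proof.
rewrite /Fi; apply: differentiableD => //.
apply: (@differentiableZ _ _ _ (fun C : MB => frob2 (fun_D p i x - row i C) : R^o)).
apply: differentiable_frob2 => k j.
have -> : (fun C : MB => (fun_D p i x - row i C) k j : R^o) =
    cst (fun_D p i x k j) - (fun C : MB => C i j : R^o).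
  by apply/funext => C; rewrite !mxE.
by apply: differentiableB => //; exact: differentiable_coord.
Qed.

Lemma F_fct_x B : (fun y => F p y B) = n%:R^-1 *: \sum_i (fun y => Fi p i y (row i B)).
Proof. by apply/funext => y; rewrite /F /mean fctE fct_sumE. Qed.

Lemma F_fct_B x : F p x = n%:R^-1 *: \sum_i (fun C : MB => Fi p i x (row i C) : R^o).
Proof. by apply/funext => y; rewrite /F /mean fctE fct_sumE. Qed.

Lemma differentiable_F_x B x : differentiable (fun y => F p y B) x.
Proof.
rewrite F_fct_x; apply: differentiableZ; apply: differentiable_sum => i.
exact: differentiable_Fi_x.
Qed.

Lemma differentiable_F_B x B : differentiable (F p x) B.
Proof.
rewrite F_fct_B; apply: differentiableZ; apply: differentiable_sum => i.
exact: differentiable_Fi_B.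
Qed.

Lemma gradB_F_mean x B : gradB_F p x B = mean (fun i => gradB_Fi p i x B).
Proof.
apply: (grad_unique Hfr) => // u.
have dFi i : derivable (fun C : MB => Fi p i x (row i C) : R^o) B u.
  by apply: diff_derivable; exact: differentiable_Fi_B.
rewrite -deriveE; last exact: differentiable_F_B.
rewrite F_fct_B deriveZ; last exact: derivable_sum.
rewrite derive_sum // /mean (ipZl Hfr) (ip_suml Hfr); congr (_ * _).
apply: eq_bigr => i _; rewrite (derive_grad Hfr) //; exact: differentiable_Fi_B.
Qed.

(** The part of [Fi] that is quadratic in [b] does not involve [x]: [Fi] at [b + t *: u] is the
    affine interpolation of its values at [b] and [b + u], up to the constant [c], which
    differentiation in [x] removes. *)
Lemma gradx_Fi_affine i x b u t :
  gx i x (b + t *: u) = gx i x b + t *: (gx i x (b + u) - gx i x b).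
Proof.
have dF b' : differentiable (fun y => Fi p i y b') x by exact: differentiable_Fi_x.
have dv b' w : derivable (fun y => Fi p i y b') x w by exact: diff_derivable.
pose c := gam p / 2 * (t ^+ 2 - t) * frob2 u.
have Fe : (fun y => Fi p i y (b + t *: u)) =
    (fun y => Fi p i y b) + t *: ((fun y => Fi p i y (b + u)) - (fun y => Fi p i y b))
    + cst c.
  have Hr := @frob_inner_product R 1 d.
  apply/funext => y; rewrite !fctE /Fi /c /frob2 !opprD !addrA.
  set z := fun_D p i y - b; rewrite -[in RHS](addrA (fun_f p i y)).
  rewrite !(ip_sqB Hr) !(ipZr Hr) !(ipZl Hr) /GRing.scale /=; lra.
apply: (grad_unique Hip) => // w.
rewrite -deriveE //; rewrite [in LHS]Fe.
have dB := derivableB (dv (b + u) w) (dv b w).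
rewrite deriveD; last 2 first.
- apply: derivableD; [exact: dv|apply: derivableZ; exact: dB].
- exact: derivable_cst.
rewrite derive_cst addr0 deriveD; last 2 first.
- exact: dv.
- by apply: derivableZ; exact: dB.
rewrite (deriveZ _ dB) deriveB; [|exact: dv|exact: dv].
rewrite (ipDl Hip (gx i x b)) (ipZl Hip t) (ipBl Hip (gx i x (b + u))).
by rewrite (derive_grad Hip w fdX (dF b)) (derive_grad Hip w fdX (dF (b + u))).
Qed.

Lemma norm_dotX x : `|x| ^+ 2 = ip x x.
Proof. exact: std_norm std x. Qed.

(* Otherwise unification unfolds the differentials behind the gradients. *)
Opaque grad gradx_Fi gradx_F gradB_Fi gradB_F.

Section Variance.
Variable sigma2 : R.
Hypothesis unb : unbiased_bounded_variance p sigma2.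

Lemma gradx_F_mean x B : gradx_F p x B = mean (fun i => gx i x (row i B)).
Proof. by have [_ /(_ x B) []] := unb. Qed.

(** Keeping a single term of the averaged variance bounds each deviation by [n * sigma2], uniformly
    in [B]. *)
Lemma gradx_Fi_indep i x b b' : (1 < n)%N -> gx i x b = gx i x b'.
Proof.
move=> n1; apply: (@affine_bounded_const _ _ _ Hip n d (fun k c => gx k x c)
  (n%:R * sigma2)) => // [k c u t|B k]; first exact: gradx_Fi_affine.
rewrite -gradx_F_mean /= -norm_dotX; have [_ /(_ x B) [_]] := unb.
have n0 : 0 < n%:R :> R by rewrite ltr0n ltnW.
rewrite mean_realE mulrC ler_pdivrMr // mulrC; apply: le_trans.
by rewrite (bigD1 k) //= lerDl; apply: sumr_ge0 => j _; exact: sqr_ge0.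
Qed.

Variable LF : R.
Hypothesis mss : mean_square_smooth p LF.

(** Both gradients of [F] are means of component gradients, so Jensen's inequality passes the
    mean-square bound on to them. *)
Lemma grad_F_lipschitz x x' B B' :
  `|gradx_F p x B - gradx_F p x' B'| ^+ 2 + frob2 (gradB_F p x B - gradB_F p x' B')
  <= LF ^+ 2 * (`|x - x'| ^+ 2 + frob2 (B - B')).
Proof.
have [_ /(_ x x' B B')] := mss; apply: le_trans.
rewrite !gradx_F_mean !gradB_F_mean norm_dotX /mean -!scalerBr -!sumrB.
have h1 := ip_mean_le Hip (fun i => gx i x (row i B) - gx i x' (row i B')).
have h2 := ip_mean_le Hfr (fun i => gradB_Fi p i x B - gradB_Fi p i x' B').
apply: le_trans (lerD h1 h2) _.
rewrite !mean_realE -mulrDr -big_split /= ler_wpM2l ?invr_ge0 ?ler0n //.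
by apply: ler_sum => i _; rewrite norm_dotX.
Qed.

Lemma gradx_F_lipschitz x x' B : let g := gradx_F p x B - gradx_F p x' B in
  ip g g <= LF ^+ 2 * ip (x - x') (x - x').
Proof.
have := grad_F_lipschitz x x' B B.
have := ip_ge0 Hfr (gradB_F p x B - gradB_F p x' B).
rewrite /frob2 (subrr B) (ip0l Hfr 0) addr0.
by rewrite -!norm_dotX /=; lra.
Qed.

Lemma gradB_F_lipschitz x B B' : let g := gradB_F p x B - gradB_F p x B' in
  frob g g <= LF ^+ 2 * frob (B - B') (B - B').
Proof.
have := grad_F_lipschitz x x B B'.
have := sqr_ge0 `|gradx_F p x B - gradx_F p x B'|.
by rewrite /frob2 (subrr x) normr0 expr0n add0r /=; lra.
Qed.

Lemma gradB_F_lipschitz_joint x x' B B' :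
  frob2 (gradB_F p x B - gradB_F p x' B')
  <= LF ^+ 2 * (`|x - x'| ^+ 2 + frob2 (B - B')).
Proof.
have := grad_F_lipschitz x x' B B'.
have := sqr_ge0 `|gradx_F p x B - gradx_F p x' B'|; lra.
Qed.

Lemma F_descent_x x u B :
  F p (x + u) B <= F p x B + ip (gradx_F p x B) u + LF / 2 * `|u| ^+ 2.
Proof.
rewrite norm_dotX; apply: (descent_of_lipschitz Hip (phi := fun y => F p y B)) => //.
- by move=> y; exact: differentiable_F_x.
- by have [/ltW] := mss.
- by move=> y y'; exact: gradx_F_lipschitz.
Qed.

Lemma F_descent_B x B U :
  F p x (B + U) <= F p x B + frob (gradB_F p x B) U + LF / 2 * frob2 U.
Proof.
apply: (descent_of_lipschitz Hfr) => //.
- by move=> C; exact: differentiable_F_B.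
- by have [/ltW] := mss.
- by move=> C C'; exact: gradB_F_lipschitz.
Qed.

Definition noise i x B := gx i x (row i B) - gradx_F p x B.

Lemma sum_noise x B : \sum_i noise i x B = 0.
Proof.
apply: etrans (sum_centered (fun i => gx i x (row i B)) (std_n std)).
by apply: eq_bigr => i _; rewrite /noise (gradx_F_mean x B).
Qed.

Lemma noise_variance x B : mean (fun i => `|noise i x B| ^+ 2 : R^o) <= sigma2.
Proof. by have [_ /(_ x B) []] := unb. Qed.

Lemma noise_diff_variance x x' B B' :
  mean (fun i => `|noise i x B - noise i x' B'| ^+ 2 : R^o)
  <= LF ^+ 2 * `|x - x'| ^+ 2.
Proof.
have nE i y C : noise i y C = gx i y (row i C) - mean (fun k => gx k y (row k C)).
  by rewrite /noise (gradx_F_mean y C).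
have [n1|n1] := leqP n 1; last first.
  have -> : (fun i => `|noise i x B - noise i x' B'| ^+ 2 : R^o) = (fun i =>
      let v := (gx i x (row i B) - mean (fun k => gx k x (row k B))) -
               (gx i x' (row i B') - mean (fun k => gx k x' (row k B'))) in
      ip v v : R^o).
    by apply/funext => i; rewrite norm_dotX (nE i x B) (nE i x' B').
  (* Independence of the second argument lets both gradients be taken at the same [B], so the
     smoothness bound is used without a [B]-difference. *)
  apply: (mean_centered_sub_le Hip (w := fun k => gx k x' (row k B))) => [k|].
    exact: gradx_Fi_indep.
  have [_ /(_ x x' B B)] := mss; rewrite (subrr B) /frob2 (ip0l Hfr 0) addr0.
  apply: le_trans; rewrite !mean_realE ler_wpM2l ?invr_ge0 ?ler0n //.
  by apply: ler_sum => i _; rewrite -norm_dotX lerDl; exact: (ip_ge0 Hfr).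
(* With a single component the noise vanishes, as it sums to zero over one index. *)
have ne1 : n = 1%N by apply/eqP; rewrite eqn_leq n1 (std_n std).
have z i y C : noise i y C = 0.
  rewrite -(sum_noise y C) (bigD1 i) //= big1 ?addr0 // => j.
  rewrite -val_eqE /=; have := ltn_ord i; have := ltn_ord j.
  move: (nat_of_ord i) (nat_of_ord j).
  by move=> a c; rewrite ne1 !ltnS !leqn0 => /eqP -> /eqP ->.
rewrite mean_realE big1 ?mulr0; first by apply: mulr_ge0; exact: sqr_ge0.
by move=> i _; rewrite (z i x B) (z i x' B') subrr normr0 expr0n.
Qed.
End Variance.
End ProblemGradients.

(** * The conjugate regularizer *)

Section Conjugate.
Context {R : realType} {X : normedModType R} {n d : nat}.
Variable p : problem X n d.
Hypothesis std : standing p.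
Local Notation MB := 'M[R]_(n, d).
Local Notation Hfr := (@frob_inner_product R n d).
Implicit Types A B L M Y : MB.

Lemma regM_ge : exists c : R, forall Y, (c%:E <= regM p Y)%E.
Proof.
have [c cP] := std_inf std; exists (\sum_(i < n) c) => Y.
by rewrite /regM -sumEFin; apply: lee_sum => i _.
Qed.

Lemma regconj_gtNy L : (-oo < regconj p L)%E.
Proof.
have [z zP] := std_dom std.
pose Y : MB := \matrix_(i, j) z 0 j.
have rowY i : row i Y = z by apply/rowP => j; rewrite !mxE.
have hY : (regM p Y < +oo)%E by apply: lte_sum_pinfty => i _; rewrite rowY.
have [c /(_ Y) cP] := regM_ge.
apply: (@lt_le_trans _ _ ((frob L Y)%:E - regM p Y)%E); last first.
  by apply: ereal_sup_ubound; exists Y.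
by move: hY cP; case: (regM p Y) => [r||] //= _ _; rewrite ltNyr.
Qed.

Lemma regconj0_lty : (regconj p 0 < +oo)%E.
Proof.
have [c cP] := regM_ge.
apply: (@le_lt_trans _ _ (- c)%:E); last exact: ltry.
apply: ge_ereal_sup => _ [Y _ <-]; rewrite (ip0l Hfr) add0e EFinN leeN2.
exact: cP.
Qed.

(** The conjugate is a supremum of affine functions. Real upper bounds [a] and [b] keep
    indeterminate extended sums out of the convex combination. *)
Lemma regconj_convex L M (a b t : R) : 0 <= t <= 1 ->
  (regconj p L <= a%:E)%E -> (regconj p M <= b%:E)%E ->
  (regconj p (L + t *: (M - L)) <= ((1 - t) * a + t * b)%:E)%E.
Proof.
move=> /andP[t0 t1] La Mb; apply: ge_ereal_sup => _ [Y _ <-].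
have hL : ((frob L Y)%:E - regM p Y <= a%:E)%E.
  by apply: le_trans La; apply: ereal_sup_ubound; exists Y.
have hM : ((frob M Y)%:E - regM p Y <= b%:E)%E.
  by apply: le_trans Mb; apply: ereal_sup_ubound; exists Y.
have [c /(_ Y)] := regM_ge; move: hL hM.
case: (regM p Y) => [r||] //=; last by move=> _ _ _; rewrite addeNy leNye.
rewrite -!EFinD !lee_fin => hL hM _.
rewrite (ipDl Hfr) (ipZl Hfr) (ipBl Hfr); nra.
Qed.

(** First-order optimality without differentiating the conjugate: compare [L'] with the point at
    fraction [t] on the segment towards [M], use convexity, divide by [t], and let [t] tend to 0. *)
Lemma L_update_subdiff tau B B' L L' : 0 < tau -> L_update p tau B B' L L' ->
  subdiff (regconj p) L' (2 *: B' - B - tau *: (L' - L)).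
Proof.
move=> tau0 am.
(* The competitor 0 has a finite objective, because the regularizer is bounded below; the minimum is
   therefore finite. *)
have fin : regconj p L' \is a fin_num.
  rewrite fin_numE gt_eqF ?regconj_gtNy //=.
  apply/negP => /eqP e; have := am 0; rewrite e.
  have := regconj0_lty; have := regconj_gtNy 0.
  by case: (regconj p 0) => [r||] //= _ _; rewrite -!EFinD leye_eq.
split => // M; set xi := _ - _ - _.
have := regconj_gtNy M; case eM: (regconj p M) => [m||] // _; last by rewrite leey.
rewrite -(fineK fin) -EFinD lee_fin; set a := fine _.
suff tlow t : 0 < t <= 1 ->
    a + frob xi (M - L') <= m + t * (tau / 2 * frob2 (M - L')).
  apply/ler_addgt0Pr => e e0.
  set q := tau / 2 * frob2 (M - L') in tlow.
  have q0 : 0 <= q by rewrite mulr_ge0 ?divr_ge0 ?(ltW tau0) ?(ip_ge0 Hfr).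
  (* This choice makes the remainder [t * q] at most [e]; the summand 1 covers [q = 0]. *)
  pose t := Num.min 1 (e / (q + 1)).
  have t0 : 0 < t by rewrite lt_min ltr01 divr_gt0 // ltr_wpDl.
  apply: le_trans (tlow t _) _; first by rewrite t0 ge_min lexx.
  rewrite lerD2l (@le_trans _ _ (e / (q + 1) * q)) //.
    by rewrite ler_wpM2r // ge_min lexx orbT.
  by rewrite mulrAC ler_pdivrMr ?ltr_wpDl // ler_pM2l // lerDl.
move=> /andP[t0 t1].
have := am (L' + t *: (M - L')).
have := @regconj_convex L' M a m t.
rewrite (ltW t0) t1 eM -(fineK fin) lexx => /(_ isT (lexx _) isT).
have := regconj_gtNy (L' + t *: (M - L')).
case: (regconj p (L' + t *: (M - L'))) => [r||] // _.
rewrite -/a -!EFinD !lee_fin => rle.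
have [c cE] : exists c, c = 2 *: B' - B by eexists.
have [v vE] : exists v, v = M - L' by eexists.
have [w wE] : exists w, w = L' - L by eexists.
rewrite /xi -cE -vE -wE (addrAC L') -wE => h.
have e1 : frob2 (w + t *: v) = frob2 w + 2 * t * frob w v + t ^+ 2 * frob2 v.
  by rewrite /frob2 (ip_sqD Hfr) !(ipZr Hfr) (ipZl Hfr); ring.
have e2 : frob (L' + t *: v) c = frob L' c + t * frob c v.
  by rewrite (ipDl Hfr) (ipZl Hfr) (ip_sym Hfr c).
rewrite e1 e2 in h.
by rewrite -(ler_pM2l t0) (ipBl Hfr) (ipZl Hfr); nra.
Qed.

Lemma subdiff_monotone L L' xi xi' : subdiff (regconj p) L xi ->
  subdiff (regconj p) L' xi' -> 0 <= frob (xi - xi') (L - L').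
Proof.
move=> [fL /(_ L') h] [fL' /(_ L) h'].
move: h h'; rewrite -(fineK fL) -(fineK fL') -!EFinD !lee_fin.
rewrite -(opprB L L') (ipNr Hfr) (ipBl Hfr); lra.
Qed.

(** Subtracting the two optimality conditions, monotonicity of the subdifferential gives
    [0 <= - tau * frob2 (M - M')]. *)
Lemma L_update_unique tau B B' L M M' : 0 < tau ->
  L_update p tau B B' L M -> L_update p tau B B' L M' -> M = M'.
Proof.
move=> t0 /(L_update_subdiff t0) h /(L_update_subdiff t0) h'.
have := subdiff_monotone h h'; rewrite opprD addrACA subrr add0r opprK -scalerN -scalerDr.
have -> : - (M - L) + (M' - L) = - (M - M').
  by rewrite !opprB addrC subrKA.
rewrite (ipZl Hfr) (ipNl Hfr) mulrN oppr_ge0 pmulr_rle0 // => h0.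
apply/eqP; rewrite -subr_eq0; apply/eqP/(ip_eq0 Hfr)/eqP.
by rewrite eq_le h0 (ip_ge0 Hfr).
Qed.
End Conjugate.

(** * Descent along a sample path *)

(** The left side is the subgradient produced by the [L]-update. Two consecutive [B]-updates
    eliminate both multipliers from it, leaving only the next [B] and a difference of gradients. *)
Lemma primal_dual_two_steps {R : realType} {n d : nat} (t : R)
    (b0 b1 b2 g0 g1 l0 l1 : 'M[R]_(n, d)) :
  b1 = b0 - t *: (g0 + l0) -> b2 = b1 - t *: (g1 + l1) ->
  2 *: b1 - b0 - t *: (l1 - l0) = b2 + t *: (g1 - g0).
Proof.
move=> e1 e2; apply/matrixP => i j; move: (congr1 (fun A : 'M[R]_(n, d) => A i j) e1).
move: (congr1 (fun A : 'M[R]_(n, d) => A i j) e2); rewrite !mxE; lra.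
Qed.

(** Multiplier increments are expressed by [B]-steps and gradient increments, which the Lyapunov
    function can control. *)
Lemma primal_dual_difference {R : realType} {n d : nat} (t : R)
    (b0 b1 b2 g0 g1 l0 l1 : 'M[R]_(n, d)) :
  b1 = b0 - t *: (g0 + l0) -> b2 = b1 - t *: (g1 + l1) ->
  b2 - b1 - (b1 - b0) + t *: (g1 - g0) = - (t *: (l1 - l0)).
Proof.
move=> e1 e2; apply/matrixP => i j; move: (congr1 (fun A : 'M[R]_(n, d) => A i j) e1).
move: (congr1 (fun A : 'M[R]_(n, d) => A i j) e2); rewrite !mxE; lra.
Qed.

(** Expanding [(tau^-1 + LF)^2] in [K2] yields [K1], [K4] and the cross term [6 * delta * LF], which
    is dropped. *)
Lemma K2_le {R : realType} (LF tau delta : R) : 0 < tau -> 0 < delta -> 0 < LF ->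
  K2 LF tau delta <= 2 / tau - LF - (K1 tau delta + K4 LF tau delta).
Proof.
move=> tau0 delta0 LF0; rewrite /K2 /K1 /K4.
have -> : 3 * delta * tau * (tau^-1 + LF) ^+ 2 =
  3 * delta / tau + 6 * delta * LF + 3 * delta * tau * LF ^+ 2.
  by field; rewrite gt_eqF.
have := mulr_ge0 (ltW delta0) (ltW LF0); lra.
Qed.

Section Path.
Opaque grad gradx_F gradB_F.
Context {R : realType} {X : normedModType R} {n d : nat}.
Variable p : problem X n d.
Hypothesis std : standing p.
Local Notation MB := 'M[R]_(n, d).
Local Notation Hfr := (@frob_inner_product R n d).
Local Notation Hip := (dotX_inner_product p).
Variables (LF tau delta e : R).
Variable sigma2 : R.
Hypothesis unb : unbiased_bounded_variance p sigma2.
Hypothesis mss : mean_square_smooth p LF.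
Hypothesis tau_gt0 : 0 < tau.
Hypothesis delta_gt0 : 0 < delta.
Variables (x D : nat -> X) (B L : nat -> MB).
Hypothesis x_step : forall k, (1 <= k)%N -> x k.+1 = x k - e *: D k.
Hypothesis B_step : forall k, (1 <= k)%N ->
  B_update p tau (x k.+1) (B k) (L k) (B k.+1).
Hypothesis L_step : forall k, (1 <= k)%N ->
  L_update p tau (B k) (B k.+1) (L k) (L k.+1).
Hypothesis index0 : index0_point p tau (x 1%N) (B 0%N) (B 1%N) (L 1%N).

(** The shifted index is that of the algorithm: this is the gradient used in the update that
    produces [B k]. *)
Let g k := gradB_F p (x k) (B k.-1).
Let dB k := B k - B k.-1.
Let xi k := B k.+1 + tau *: (g k.+1 - g k).
Let K1' := K1 tau delta.
Let K2' := K2 LF tau delta.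
Let K3' := K3 LF tau delta.
Let K4' := K4 LF tau delta.

Lemma B_stepE k : (1 <= k)%N -> B k.+1 = B k - tau *: (g k.+1 + L k).
Proof. exact: B_step. Qed.

Lemma multiplier_dB k : (1 <= k)%N -> g k.+1 + L k = - (tau^-1 *: dB k.+1).
Proof.
move=> k1; rewrite /dB /= B_stepE // addrAC subrr add0r scalerN opprK scalerA.
by rewrite mulVf ?gt_eqF // scale1r.
Qed.

(** At [k = 1] the multiplier is supplied by [index0]; for larger [k] it is the previous iterate. *)
Lemma prev_multiplier k : (1 <= k)%N -> exists L', B_update p tau (x k) (B k.-1) L' (B k) /\
  L_update p tau (B k.-1) (B k) L' (L k).
Proof.
case: k => // -[|k] _; first exact: index0.
by exists (L k.+1); split; [exact: B_step | exact: L_step].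
Qed.

Lemma subdiff_xi k : (1 <= k)%N -> subdiff (regconj p) (L k) (xi k).
Proof.
move=> k1; have [L' [hB hL]] := prev_multiplier k1.
have := L_update_subdiff std tau_gt0 hL.
by rewrite (primal_dual_two_steps hB (B_stepE k1)).
Qed.

Lemma regconj_fin k : (1 <= k)%N -> regconj p (L k) \is a fin_num.
Proof. by move=> /subdiff_xi[]. Qed.

Definition lagr k := F p (x k) (B k) + frob (B k) (L k) - fine (regconj p (L k)).

Lemma LagE k : (1 <= k)%N -> Lag p (x k) (B k) (L k) = (lagr k)%:E.
Proof. by move=> k1; rewrite /Lag -(fineK (regconj_fin k1)). Qed.

Lemma dB_multiplier k : (1 <= k)%N ->
  dB k.+2 - dB k.+1 + tau *: (g k.+2 - g k.+1) = - (tau *: (L k.+1 - L k)).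
Proof.
move=> k1; exact: primal_dual_difference (B_stepE k1) (B_stepE (leqW k1)).
Qed.

Lemma g_diff_le k : (1 <= k)%N ->
  frob2 (g k.+1 - g k) <= LF ^+ 2 * (2 * Delta_x x k.+1 + 2 * Delta_B B k).
Proof.
move=> k1; have := gradB_F_lipschitz_joint std unb mss (x k.+1) (x k) (B k) (B k.-1).
by rewrite /Delta_x /Delta_B !(mulrC 2) !divfK.
Qed.

(** The change is split into an [x]-step and a [B]-step, both bounded by the descent inequality, and
    an [L]-step, bounded by convexity of the conjugate. The [B]-update turns the linear term of the
    [B]-step into [- 2 / tau * Delta_B B k.+1], the leading part of [K2]. *)
Lemma lagr_step k : (1 <= k)%N ->
  lagr k.+1 - lagr k <= dotX p (gradx_F p (x k) (B k)) (x k.+1 - x k)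
    + (LF + K3') * Delta_x x k.+1 + K4' * Delta_x x k.+2
    + K1' * Delta_B B k.+2 - K2' * Delta_B B k.+1 + K3' * Delta_B B k.
Proof.
move=> k1.
have hx := F_descent_x std unb mss (x k) (x k.+1 - x k) (B k).
rewrite (addrC (x k)) subrK in hx.
have hB := F_descent_B std unb mss (x k.+1) (B k) (dB k.+1).
rewrite /dB /= (addrC (B k)) subrK -/(dB k.+1) in hB.
have hL : fine (regconj p (L k)) + frob (xi k) (L k.+1 - L k)
    <= fine (regconj p (L k.+1)).
  have [_ /(_ (L k.+1))] := subdiff_xi k1.
  by rewrite -(fineK (regconj_fin k1)) -(fineK (regconj_fin (leqW k1))) lee_fin.
have hg : frob (g k.+1 + L k) (dB k.+1) = - (frob2 (dB k.+1) / tau).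
  by rewrite multiplier_dB // (ipNl Hfr) (ipZl Hfr) mulrC.
(* This is [- tau] times the multiplier increment, by [dB_multiplier]; the [L]-step thus costs the
   inner product of [g k.+1 - g k] with [c]. *)
pose c := dB k.+2 - dB k.+1 + tau *: (g k.+2 - g k.+1).
have hxi : frob (B k.+1 - xi k) (L k.+1 - L k) = frob (g k.+1 - g k) c.
  rewrite /c dB_multiplier // (ipNr Hfr) (ipZr Hfr) /xi opprD addrA subrr add0r.
  by rewrite (ipNl Hfr) (ipZl Hfr).
(* The weight [tau / delta] is the origin of the constants: the gradient increment is charged to
   [K3], and the three parts of [c] to [K1] (twice) and [K4]. *)
have young := ip_young Hfr (g k.+1 - g k) c (divr_gt0 tau_gt0 delta_gt0).
have c3 := ip_sqD_le3 Hfr (dB k.+2) (- dB k.+1) (tau *: (g k.+2 - g k.+1)).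
rewrite (ipNl Hfr) (ipNr Hfr) opprK (ipZl Hfr) (ipZr Hfr) -/c in c3.
have l1 := g_diff_le k1; have l2 := g_diff_le (leqW k1).
have eB j : frob2 (dB j) = 2 * Delta_B B j by rewrite mulrC divfK.
have ex : `|x k.+1 - x k| ^+ 2 = 2 * Delta_x x k.+1 by rewrite mulrC divfK.
have [LF0 _] := mss.
have lagE : lagr k.+1 - lagr k =
    (F p (x k.+1) (B k.+1) - F p (x k.+1) (B k) + frob (L k) (dB k.+1))
    + (F p (x k.+1) (B k) - F p (x k) (B k))
    + (frob (B k.+1) (L k.+1 - L k) - fine (regconj p (L k.+1)) + fine (regconj p (L k))).
  by rewrite /lagr /dB !(ipBr Hfr) /= !(ip_sym Hfr (L k)); ring.
move: hB hg hxi hL; rewrite (ipDl Hfr) (ipBl Hfr) => hB hg hxi hL.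
rewrite ex in hx; rewrite !eB in hB hg.
move: c3; rewrite -!/(frob2 _) !eB => c3; rewrite -!/(frob2 _) in young.
have DB0 : 0 <= Delta_B B k.+1 by rewrite divr_ge0 ?(ip_ge0 Hfr).
have y1 : tau / delta / 2 * frob2 (g k.+1 - g k) <=
    K3' * (Delta_x x k.+1 + Delta_B B k).
  have -> : K3' * (Delta_x x k.+1 + Delta_B B k) = tau / delta / 2 *
      (LF ^+ 2 * (2 * Delta_x x k.+1 + 2 * Delta_B B k)).
    by rewrite /K3' /K3; field; rewrite gt_eqF.
  by rewrite ler_wpM2l // !divr_ge0 // ltW.
have y2 : (2 * (tau / delta))^-1 * frob2 c <= K1' * Delta_B B k.+2
     + K1' * Delta_B B k.+1 + K4' * (Delta_x x k.+2 + Delta_B B k.+1).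
  have -> : K1' * Delta_B B k.+2
     + K1' * Delta_B B k.+1 + K4' * (Delta_x x k.+2 + Delta_B B k.+1) =
    (2 * (tau / delta))^-1 * (3 * (2 * Delta_B B k.+2) + 3 * (2 * Delta_B B k.+1)
      + 3 * (tau * (tau * (LF ^+ 2 * (2 * Delta_x x k.+2 + 2 * Delta_B B k.+1))))).
    by rewrite /K1' /K1 /K4' /K4; field; rewrite !gt_eqF.
  apply: ler_wpM2l; first by rewrite invr_ge0 mulr_ge0 // divr_ge0 // ltW.
  apply: le_trans c3 _; rewrite lerD2l ler_pM2l // !ler_pM2l //.
have k2 : K2' * Delta_B B k.+1 <=
    (2 / tau - LF) * Delta_B B k.+1 - (K1' + K4') * Delta_B B k.+1.
  by rewrite -mulrBl; apply: ler_wpM2r => //; exact: K2_le.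
rewrite lagE; move: hB hx hL hg hxi young y1 y2 k2.
rewrite -[gradB_F p (x k.+1) (B k)]/(g k.+1).
clear l1 l2 c3 lagE ex DB0.
generalize (F p (x k.+1) (B k.+1)) (F p (x k.+1) (B k)) (F p (x k) (B k))
  (frob (g k.+1) (dB k.+1)) (frob (L k) (dB k.+1)) (fine (regconj p (L k)))
  (fine (regconj p (L k.+1))) (frob (xi k) (L k.+1 - L k))
  (frob (B k.+1) (L k.+1 - L k)) (frob (g k.+1 - g k) c) (frob2 (g k.+1 - g k))
  (frob2 c) (dotX p (gradx_F p (x k) (B k)) (x k.+1 - x k))
  (Delta_B B k) (Delta_B B k.+1) (Delta_B B k.+2) (Delta_x x k.+1) (Delta_x x k.+2).
move=> *; lra.
Qed.

Definition psi k := lagr k - K1' * Delta_B B k.+1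
  + (K2' - K1' + K3') / 2 * Delta_B B k - K4' * Delta_x x k.+1.

Lemma PsiE k : (1 <= k)%N -> Psi p LF tau delta x B L k = (psi k)%:E.
Proof. by move=> k1; rewrite /Psi LagE // -EFinD /psi mulNr !addrA. Qed.

Let kappa := (K2' - K1' - K3') / 2.
Definition err k := D k - gradx_F p (x k) (B k).

Lemma Delta_xE k : (1 <= k)%N -> Delta_x x k.+1 = e ^+ 2 * `|D k| ^+ 2 / 2.
Proof.
move=> k1; rewrite /Delta_x /= x_step // addrAC subrr add0r normrN normrZ exprMn.
by rewrite real_normK ?num_real.
Qed.

(** The terms of [psi] at the next iterate cancel the forward terms of [lagr_step]. The [x]-steps
    collect [LF + K3 + K4], which is [Ltilde], and the coefficient [C2] is the one that leaves the
    same decrease [kappa] on both [B]-steps. The error enters by polarization of the inner product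
    of the gradient with [D k]. *)
Lemma psi_step k : (1 <= k)%N ->
  psi k.+1 <= psi k - e / 2 * `|gradx_F p (x k) (B k)| ^+ 2
    - e / 2 * (1 - Ltilde LF tau delta * e) * `|D k| ^+ 2
    + e / 2 * `|err k| ^+ 2 - kappa * (Delta_B B k.+1 + Delta_B B k).
Proof.
move=> k1; have := lagr_step k1; rewrite (Delta_xE k1) => h.
have gD : dotX p (gradx_F p (x k) (B k)) (x k.+1 - x k) =
    - (e / 2) * (`|gradx_F p (x k) (B k)| ^+ 2 + `|D k| ^+ 2 - `|err k| ^+ 2).
  rewrite !(norm_dotX std) /err (ip_sqB Hip) x_step // addrAC subrr add0r.
  by rewrite (ipNr Hip) (ipZr Hip) (ip_sym Hip (D k)); field.
rewrite gD in h; rewrite /psi (Delta_xE k1) /kappa.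
have -> : Ltilde LF tau delta = LF + K3' + K4' by [].
lra.
Qed.

Definition dist_bound k := `|gradx_F p (x k) (B k)| ^+ 2
   + (2 * LF ^+ 2 + 2 * tau ^+ 2 * LF ^+ 2) * (2 * Delta_x x k.+1)
   + (2 / tau ^+ 2 + 2 + 2 * tau ^+ 2 * LF ^+ 2) * (2 * Delta_B B k.+1 + 2 * Delta_B B k).

Lemma dist0_ge0 (A : set (X * MB * MB)) : (0 <= dist0 A)%E.
Proof. by apply: le_ereal_inf_tmp => _ [v _ <-]; rewrite lee_fin sqrtr_ge0. Qed.

(** The element of the subdifferential is the one given by [xi k]. The [B]-update rewrites its
    second component as a gradient increment minus [dB k.+1 / tau], and the definition of [xi] its
    third as [- dB k.+1] minus [tau] times a gradient increment. *)
Lemma dist0_le k : (1 <= k)%N ->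
  (dist0 (partial_Lag p (x k) (B k) (L k)) ^+ 2 <= (dist_bound k)%:E)%E.
Proof.
move=> k1.
pose v2 := gradB_F p (x k) (B k) + L k.
pose v3 := B k - xi k.
pose N := `|gradx_F p (x k) (B k)| ^+ 2 + frob2 v2 + frob2 v3.
have N0 : 0 <= N by rewrite !addr_ge0 ?sqr_ge0 ?(ip_ge0 Hfr).
have dN : (dist0 (partial_Lag p (x k) (B k) (L k)) <= (Num.sqrt N)%:E)%E.
  apply: ereal_inf_lbound; exists (gradx_F p (x k) (B k), v2, v3) => //.
  split => //=; exists (xi k) => //; exact: subdiff_xi.
apply: (@le_trans _ _ (N%:E)).
  rewrite -[in X in (_ <= X)%E](sqr_sqrtr N0) EFin_expe.
  by rewrite !expe2; apply: lee_pmul => //; exact: dist0_ge0.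
rewrite lee_fin /N /dist_bound -!addrA lerD2l.
have eB j : frob2 (dB j) = 2 * Delta_B B j by rewrite mulrC divfK.
have h2 : frob2 v2 <= 2 * (LF ^+ 2 * (2 * Delta_x x k.+1))
    + 2 * (tau^-1 ^+ 2 * (2 * Delta_B B k.+1)).
  have v2E : v2 = (gradB_F p (x k) (B k) - g k.+1) + (- tau^-1) *: dB k.+1.
    by rewrite scaleNr -multiplier_dB // addrA subrK.
  have := ip_sqD_le2 Hfr (gradB_F p (x k) (B k) - g k.+1) ((- tau^-1) *: dB k.+1).
  rewrite -v2E -!/(frob2 _) => h; apply: le_trans h _.
  have l := gradB_F_lipschitz_joint std unb mss (x k) (x k.+1) (B k) (B k).
  rewrite (subrr (B k)) /frob2 (ip0l Hfr 0) addr0 -!/(frob2 _) distrC in l.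
  have ex : `|x k.+1 - x k| ^+ 2 = 2 * Delta_x x k.+1 by rewrite mulrC divfK.
  rewrite ex in l.
  apply: lerD; first by rewrite ler_pM2l.
  by rewrite /frob2 (ipZl Hfr) (ipZr Hfr) -/(frob2 _) eB mulrA mulrNN -expr2.
have h3 : frob2 v3 <= 2 * (2 * Delta_B B k.+1)
    + 2 * (tau ^+ 2 * (LF ^+ 2 * (2 * Delta_x x k.+1 + 2 * Delta_B B k))).
  have v3E : v3 = - dB k.+1 + (- tau) *: (g k.+1 - g k).
    by rewrite /v3 /xi /dB /= opprB opprD addrA scaleNr.
  have := ip_sqD_le2 Hfr (- dB k.+1) ((- tau) *: (g k.+1 - g k)).
  rewrite -v3E (ipNl Hfr) (ipNr Hfr) opprK (ipZl Hfr) (ipZr Hfr) mulrA mulrNN -expr2.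
  rewrite -!/(frob2 _) eB => h; apply: le_trans h _.
  by rewrite lerD2l ler_pM2l // ler_pM2l ?exprn_gt0 // g_diff_le.
have DB0 j : 0 <= Delta_B B j by rewrite divr_ge0 ?(ip_ge0 Hfr).
have Dx0 : 0 <= Delta_x x k.+1 by rewrite divr_ge0 ?sqr_ge0.
apply: le_trans (lerD h2 h3) _; rewrite exprVn.
have t2 : 0 <= (tau ^+ 2)^-1 by rewrite invr_ge0 sqr_ge0.
have tL : 0 <= tau ^+ 2 * LF ^+ 2 by rewrite mulr_ge0 ?sqr_ge0.
have := mulr_ge0 t2 (DB0 k); have := mulr_ge0 tL (DB0 k.+1).
have := DB0 k; lra.
Qed.
End Path.

(** * Mini-batches *)

Section BatchSampling.
Context {R : realType} {n : nat}.

Definition batch_weight (m : nat) (A : {set 'I_n}) : R :=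
  if #|A| == m then 'C(n, m)%:R^-1 else 0.

Lemma batch_weight_ge0 m A : 0 <= batch_weight m A.
Proof. by rewrite /batch_weight; case: ifP => // _; rewrite invr_ge0 ler0n. Qed.

Lemma sum_batch_weight m : (m <= n)%N -> \sum_A batch_weight m A = 1.
Proof.
move=> mn; rewrite -big_mkcond /= sumr_const.
have -> : #|[pred A : {set 'I_n} | #|A| == m]| = 'C(n, m).
  by have := card_draws 'I_n m; rewrite card_ord => <-; apply: eq_card => A; rewrite !inE.
by rewrite -[_ *+ _]mulr_natl divff // pnatr_eq0 -lt0n bin_gt0.
Qed.

Lemma batch_weight_perm m (s : {perm 'I_n}) (f : {set 'I_n} -> R) :
  \sum_A batch_weight m A * f A = \sum_A batch_weight m A * f (s @: A).
Proof.
rewrite (reindex_inj (imset_inj (@perm_inj _ s))); apply: eq_bigr => A _.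
by rewrite /batch_weight card_imset //; exact: perm_inj.
Qed.

Let p1 m (j : 'I_n) : R := \sum_A batch_weight m A * (j \in A)%:R.
Let p2 m (j l : 'I_n) : R := \sum_A batch_weight m A * ((j \in A) && (l \in A))%:R.

Lemma mem_perm_imset (s : {perm 'I_n}) (A : {set 'I_n}) j : (s j \in s @: A) = (j \in A).
Proof. by rewrite mem_imset //; exact: perm_inj. Qed.

(** Transpositions make the inclusion probability the same for all indices, and these probabilities
    add up to the batch size. *)
Lemma inclusion_prob m j : (m <= n)%N -> p1 m j = m%:R / n%:R.
Proof.
move=> mn; have n0 : n%:R != 0 :> R.
  by rewrite pnatr_eq0 -lt0n (leq_trans _ (ltn_ord j)).
have pj l : p1 m l = p1 m j.
  rewrite /p1 (batch_weight_perm m (tperm l j)); apply: eq_bigr => A _.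
  by have := mem_perm_imset (tperm l j) A j; rewrite tpermR => ->.
have : \sum_l p1 m l = m%:R.
  rewrite exchange_big /= -[RHS]mul1r -[X in _ = X * _](sum_batch_weight mn) mulr_suml.
  apply: eq_bigr => A _; rewrite -mulr_sumr -natr_sum.
  have -> : (\sum_(i < n) (i \in A))%N = #|A|.
    by rewrite -sum1_card [RHS]big_mkcond; apply: eq_bigr => i _; case: (i \in A).
  rewrite /batch_weight.
  by case: eqP => [->|_]; rewrite ?mul0r.
rewrite (eq_bigr (fun=> p1 m j)) => [|l _]; last exact: pj.
by rewrite sumr_const card_ord => <-; rewrite -[p1 m j *+ n]mulr_natr mulfK.
Qed.

Lemma pair_inclusion_prob m j l l' : l != j -> l' != j -> p2 m j l = p2 m j l'.
Proof.
move=> lj l'j; rewrite /p2 (batch_weight_perm m (tperm l l')); apply: eq_bigr => A _.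
have := mem_perm_imset (tperm l l') A j; rewrite tpermD // => ->.
by have := mem_perm_imset (tperm l l') A l'; rewrite tpermR => ->.
Qed.

Lemma pair_inclusion_ge0 m j l : 0 <= p2 m j l.
Proof. by apply: sumr_ge0 => A _; rewrite mulr_ge0 ?batch_weight_ge0 ?ler0n. Qed.

Lemma sum_mem_scale {V : lmodType R} (A : {set 'I_n}) (v : 'I_n -> V) :
  \sum_(j in A) v j = \sum_j (j \in A)%:R *: v j.
Proof.
by rewrite big_mkcond; apply: eq_bigr => j _; case: (j \in A); rewrite ?scale1r ?scale0r.
Qed.

Lemma batch_mean {V : lmodType R} (m : nat) (v : 'I_n -> V) : (m <= n)%N ->
  \sum_j v j = 0 -> \sum_A batch_weight m A *: \sum_(j in A) v j = 0.
Proof.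
move=> mn v0; under eq_bigr do rewrite sum_mem_scale scaler_sumr.
rewrite exchange_big /= (eq_bigr (fun j => (m%:R / n%:R) *: v j)) => [|j _].
  by rewrite -scaler_sumr v0 scaler0.
under eq_bigr do rewrite scalerA.
by rewrite -scaler_suml -/(p1 m j) inclusion_prob.
Qed.

(* Sampling without replacement: the cross terms are nonpositive because
   [\sum_(l != j) v l = - v j] and [p2 m j l] does not depend on [l != j]. *)
Lemma batch_sum_variance {V : lmodType R} {ip : V -> V -> R} (H : inner_product ip)
    (m : nat) (v : 'I_n -> V) : (m <= n)%N -> \sum_j v j = 0 ->
  \sum_A batch_weight m A * ip (\sum_(j in A) v j) (\sum_(j in A) v j)
    <= m%:R / n%:R * \sum_j ip (v j) (v j).
Proof.
move=> mn v0.
have -> : \sum_A batch_weight m A * ip (\sum_(j in A) v j) (\sum_(j in A) v j) =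
    \sum_j \sum_l p2 m j l * ip (v j) (v l).
  under eq_bigr => A _.
    rewrite !sum_mem_scale (ip_suml H) mulr_sumr.
    under eq_bigr => j _.
      rewrite (ip_sumr H) mulr_sumr.
      under eq_bigr => l _ do
        rewrite (ipZl H) (ipZr H) !mulrA -(mulrA (batch_weight _ _)) -natrM mulnb.
    over.
  over.
  rewrite exchange_big; apply: eq_bigr => j _ /=.
  by rewrite exchange_big; apply: eq_bigr => l _ /=; rewrite -mulr_suml.
rewrite mulr_sumr; apply: ler_sum => j _; rewrite (bigD1 j) //=.
have -> : p2 m j j = m%:R / n%:R.
  by rewrite -(inclusion_prob j mn); apply: eq_bigr => A _; rewrite andbb.
rewrite gerDl; have [l0 l0j|noj] := pickP (fun l => l != j); last first.
  by rewrite big_pred0.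
rewrite (eq_bigr (fun l => p2 m j l0 * ip (v j) (v l))) => [|l lj]; last first.
  by rewrite (pair_inclusion_prob m lj l0j).
rewrite -mulr_sumr -(ip_sumr H).
have -> : \sum_(l | l != j) v l = - v j.
  by move: v0; rewrite (bigD1 j) //= addrC => /eqP; rewrite addr_eq0 => /eqP.
by rewrite (ipNr H) mulrN oppr_le0 mulr_ge0 ?pair_inclusion_ge0 ?(ip_ge0 H).
Qed.

Lemma batch_variance {V : lmodType R} {ip : V -> V -> R} (H : inner_product ip)
    (b : nat) (v : 'I_n -> V) (K : R) : (0 < n)%N -> (0 < b)%N ->
  \sum_j v j = 0 -> mean (fun i => ip (v i) (v i) : R^o) <= K ->
  \sum_A batch_weight (minn n b) A *
    (let s := #|A|%:R^-1 *: \sum_(j in A) v j in ip s s) <= K / b%:R.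
Proof.
move=> n0 b0 v0; rewrite mean_realE => vK.
have K0 : 0 <= K.
  apply: le_trans vK; rewrite mulr_ge0 ?invr_ge0 ?ler0n //.
  by apply: sumr_ge0 => i _; exact: ip_ge0.
(* A batch capped at the whole index set averages a centered family to 0; otherwise the cap is
   inactive. *)
have [nb|bn] := leqP n b.
  rewrite big1 ?divr_ge0 ?ler0n // => A _.
  rewrite /batch_weight; case: eqP => [An|_]; last by rewrite mul0r.
  have -> : A = [set: 'I_n]%SET.
    by apply/eqP; rewrite eqEcard finset.subsetT cardsT card_ord An leqnn.
  rewrite (_ : \sum_(j in _) v j = 0) ?scaler0 ?(ip0l H) ?mulr0 //.
  by rewrite -[RHS]v0; apply: eq_bigl => j; rewrite inE.
have m0 : b%:R != 0 :> R by rewrite pnatr_eq0 -lt0n.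
have -> : \sum_A batch_weight b A *
    (let s := #|A|%:R^-1 *: \sum_(j in A) v j in ip s s) =
    b%:R ^- 2 * \sum_A batch_weight b A * ip (\sum_(j in A) v j) (\sum_(j in A) v j).
  rewrite mulr_sumr; apply: eq_bigr => A _ /=.
  rewrite (ipZl H) (ipZr H) /batch_weight; case: eqP => [->|_]; last by rewrite !mul0r mulr0.
  by rewrite -exprVn; ring.
have := batch_sum_variance H (ltnW bn) v0.
rewrite -(@ler_pM2l _ (b%:R ^- 2)) ?invr_gt0 ?exprn_gt0 ?ltr0n // => /le_trans; apply.
have -> : b%:R ^- 2 * (b%:R / n%:R * \sum_j ip (v j) (v j)) =
   (n%:R^-1 * \sum_j ip (v j) (v j)) / b%:R.
  by field; rewrite m0 pnatr_eq0 -lt0n.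
by rewrite ler_pM2r // invr_gt0 ltr0n.
Qed.
(** The batch average has mean zero, so its cross term with the fixed shift [u] disappears. *)
Lemma batch_shift_variance {V : lmodType R} {ip : V -> V -> R}
    (H : inner_product ip) (b : nat) (u : V) (v : 'I_n -> V) (K : R) :
  (0 < n)%N -> (0 < b)%N ->
  \sum_j v j = 0 -> mean (fun i => ip (v i) (v i) : R^o) <= K ->
  \sum_A batch_weight (minn n b) A *
    (let s := u + #|A|%:R^-1 *: \sum_(j in A) v j in ip s s) <= ip u u + K / b%:R.
Proof.
move=> n0 b0 v0 vK; set m := minn n b; have mn : (m <= n)%N by exact: geq_minl.
pose s (A : {set 'I_n}) := #|A|%:R^-1 *: \sum_(j in A) v j.
have mean0 : \sum_A batch_weight m A *: s A = 0.
  rewrite (eq_bigr (fun A => m%:R^-1 *: (batch_weight m A *: \sum_(j in A) v j))).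
    by rewrite -scaler_sumr batch_mean // scaler0.
  move=> A _; rewrite /s !scalerA /batch_weight; case: eqP => [->|_].
    by rewrite mulrC.
  by rewrite mul0r mulr0 !scale0r.
have -> : \sum_A batch_weight m A *
    (let s := u + #|A|%:R^-1 *: \sum_(j in A) v j in ip s s) =
  \sum_A (batch_weight m A * ip u u + (2 * ip u (batch_weight m A *: s A)
    + batch_weight m A * ip (s A) (s A))).
  apply: eq_bigr => A _; rewrite /= -/(s A) (ip_sqD H) (ipZr H (batch_weight m A)); ring.
rewrite !big_split /= -mulr_suml sum_batch_weight // mul1r lerD2l.
rewrite -mulr_sumr -(ip_sumr H) mean0 (ip0r H) mulr0 add0r.
exact: batch_variance.
Qed.
End BatchSampling.

(** * Product weights and the resampling of one coordinate *)

Section ProductWeights.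
Context {R : realType} {I C : finType} (w : I -> C -> R).
Hypothesis w1 : forall i, \sum_c w i c = 1.

Definition product_weight (A : {ffun I -> C}) : R := \prod_i w i (A i).

Definition resample (A : {ffun I -> C}) (i : I) (c : C) : {ffun I -> C} :=
  [ffun j => if j == i then c else A j].

Lemma sum_product_weight : \sum_A product_weight A = 1.
Proof. by rewrite -bigA_distr_bigA /=; apply: big1 => i _; exact: w1. Qed.

(** Cross-multiplied, so that it also holds when the weight of the replaced coordinate is zero. *)
Lemma product_weight_resample A i c :
  product_weight (resample A i c) * w i (A i) = product_weight A * w i c.
Proof.
rewrite /product_weight (bigD1 i) //= [in RHS](bigD1 i) //= ffunE eqxx.
rewrite (eq_bigr (fun j => w j (A j))) => [|j ji]; first by ring.
by rewrite ffunE (negbTE ji).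
Qed.

(* The swap [(A, c) |-> (resample A i c, A i)] is an involution. *)
Lemma sum_resample (i : I) (f : {ffun I -> C} -> R) :
  \sum_A product_weight A * f A =
  \sum_A product_weight A * \sum_c w i c * f (resample A i c).
Proof.
pose swap (z : {ffun I -> C} * C) := (resample z.1 i z.2, z.1 i).
have swapK : involutive swap.
  move=> [A c]; rewrite /swap /= ffunE eqxx; congr (_, _).
  by apply/ffunP => j; rewrite !ffunE; case: eqP => // ->.
transitivity (\sum_(z : {ffun I -> C} * C) w i z.2 * (product_weight z.1 * f z.1)).
  rewrite -(pair_bigA _ (fun A c => w i c * (product_weight A * f A))) /=.
  by apply: eq_bigr => A _; rewrite -mulr_suml w1 mul1r.
rewrite (reindex_inj (inv_inj swapK)).
rewrite -(pair_bigA _ (fun A c => w i (swap (A, c)).2 *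
  (product_weight (swap (A, c)).1 * f (swap (A, c)).1))) /=.
apply: eq_bigr => A _; rewrite mulr_sumr; apply: eq_bigr => c _.
by rewrite mulrA (mulrC (w i _)) product_weight_resample mulrA.
Qed.
End ProductWeights.

(** * Finite histories of batches *)

Section FiniteHistories.
Context {R : realType} {disp : measure_display} {Omega : measurableType disp}.
Variable P : probability Omega R.

(* No measurability of [f] is needed: the integral is a supremum over the simple
   functions below [f]. *)
Lemma ge0_le_integral_nomeas (f h : Omega -> \bar R) :
  (forall w, 0 <= f w)%E -> (forall w, f w <= h w)%E ->
  (\int[P]_w f w <= \int[P]_w h w)%E.
Proof.
move=> f0 fh; rewrite !ge0_integralTE //; last by move=> w; apply: le_trans (fh w).
apply: ereal_sup_le => _ [u /= uf <-]; exists u => // w.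
by apply: le_trans (fh w); exact: uf.
Qed.

(** Every preimage is a countable union of sets, each a fibre of [q] or empty. *)
Lemma measurable_factor (Q : countType) (q : Omega -> Q) (f : Omega -> \bar R) :
  (forall a, measurable [set w | q w = a]) ->
  (forall w w', q w = q w' -> f w = f w') -> measurable_fun setT f.
Proof.
move=> mq fq _ Y _; rewrite setTI.
have -> : f @^-1` Y = \bigcup_a [set w | q w = a /\ Y (f w)].
  by apply/seteqP; split=> [w Yw|w [a _ []] //]; exists (q w).
apply: countable_bigcupT_measurable => // a.
have [[w [<- Yw]]|no] := pselect (exists w, q w = a /\ Y (f w)).
  rewrite (_ : [set _ | _] = [set w' | q w' = q w]) //.
  by apply/seteqP; split=> w' /= => [[]//|e]; rewrite (fq _ _ e).
rewrite (_ : [set _ | _] = set0) //; apply/seteqP; split=> // w h.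
by apply: no; exists w.
Qed.

Lemma integral_simple (I : finType) (E : I -> set Omega) (c : I -> R) :
  (forall i, measurable (E i)) ->
  (\int[P]_w (\sum_i c i * \1_(E i) w)%:E = (\sum_i c i * fine (P (E i)))%:E)%E.
Proof.
move=> mE.
under eq_integral do rewrite -sumEFin.
rewrite integral_sum // => [|i]; last first.
  under eq_fun do rewrite EFinM; apply: integrableZl => //.
  exact: (@integrable_indic _ _ _ P).
rewrite -sumEFin; apply: eq_bigr => i _.
under eq_integral do rewrite EFinM.
rewrite integralZl //; last exact: (@integrable_indic _ _ _ P).
by rewrite integral_indic // setIT EFinM fineK // fin_num_measure.
Qed.

Variables (n : nat) (bs : nat -> nat) (T : nat) (S : nat -> Omega -> {set 'I_n}).
Variable r : Omega -> nat.
Hypothesis smp : uniform_sampling P bs T S r.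
Hypothesis T_gt0 : (0 < T)%N.
Variable N : nat.

Definition history (w : Omega) : {ffun 'I_N -> {set 'I_n}} := [ffun i => S (val i).+1 w].

Definition history_weight : {ffun 'I_N -> {set 'I_n}} -> R :=
  product_weight (fun i => batch_weight (bs (val i).+1)).

Lemma history_measurable A : measurable [set w | history w = A].
Proof.
have -> : [set w | history w = A] =
    \bigcap_(i in [set: 'I_N]) [set w | S (val i).+1 w = A i].
  apply/seteqP; split=> [w /= <- i _ /=|w h]; first by rewrite ffunE.
  by apply/ffunP => i; rewrite ffunE; exact: h.
by apply: fin_bigcap_measurable => // i _; exact: smp_S_meas smp _ _ _.
Qed.

Lemma atom_measurable A m : measurable [set w | history w = A /\ r w = m].
Proof.
by apply: measurableI; [exact: history_measurable | exact: smp_r_meas smp m].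
Qed.

Definition index_weight (m : nat) : R := if (2 <= m <= T.+1)%N then T%:R^-1 else 0.

Lemma atom_prob A m : P [set w | history w = A /\ r w = m] =
  (history_weight A * index_weight m)%:E.
Proof.
(* Batches are numbered from 1 and coordinates from 0, hence the predecessor; the empty set is a
   mere default beyond [N]. *)
pose A' k : {set 'I_n} := if insub k.-1 is Some i then A i else finset.set0.
have A'E (i : 'I_N) : A' i.+1 = A i by rewrite /A' /= valK.
have -> : [set w | history w = A /\ r w = m] =
    [set w | (forall k, (1 <= k <= N)%N -> S k w = A' k) /\ r w = m].
  apply/seteqP; split=> w /= [h rm]; split=> //.
    move=> [|k] //= kN; rewrite (A'E (Ordinal kN)) -h ffunE //.
  apply/ffunP => i; rewrite ffunE -A'E; apply: h; exact: (ltn_ord i).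
rewrite (smp_indep smp) (smp_r_unif smp) EFinM; congr (_ * _)%E.
rewrite big_add1 /= big_mkord /history_weight /product_weight -prodEFin.
apply: eq_bigr => i _; rewrite A'E (smp_S_unif smp) //.
Qed.

Lemma index_in_range : {ae P, forall w, (2 <= r w <= T.+1)%N}.
Proof.
have : P.-negligible (\bigcup_m [set w | ~~ (2 <= m <= T.+1)%N /\ r w = m]).
  apply: negligible_bigcup => m; have [h|h] := boolP (2 <= m <= T.+1)%N.
    have -> : [set w | ~~ true /\ r w = m] = set0 by apply/seteqP; split=> w [].
    exact: negligible_set0.
  exists [set w | r w = m]; split; first exact: smp_r_meas smp m.
    by have := smp_r_unif smp m; rewrite (negbTE h).
  by move=> w [].
by apply: negligibleS => w /= h; exists (r w) => //; split=> //; exact/negP.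
Qed.

Lemma sum_index_weight (f : nat -> R) :
  \sum_(m < T.+2) index_weight m * f m = T%:R^-1 * \sum_(2 <= m < T.+2) f m.
Proof.
rewrite -(big_mkord xpredT (fun m => index_weight m * f m)).
rewrite (@big_cat_nat _ _ _ 2) //= big_nat big1 ?add0r; last first.
  by move=> [|[|m]] //= _; rewrite /index_weight /= mul0r.
rewrite mulr_sumr !big_nat; apply: eq_bigr => m /andP[m2 mT].
by rewrite /index_weight m2 -ltnS mT.
Qed.

Lemma integral_history (f : Omega -> R) (phi : {ffun 'I_N -> {set 'I_n}} -> nat -> R) :
  (forall w, f w = phi (history w) (r w)) ->
  (\int[P]_w (f w)%:E =
   (\sum_A history_weight A * (T%:R^-1 * \sum_(2 <= m < T.+2) phi A m))%:E)%E.
Proof.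
move=> fphi; pose I := ({ffun 'I_N -> {set 'I_n}} * 'I_T.+2)%type.
pose E (z : I) := [set w | history w = z.1 /\ r w = z.2].
have mE z : measurable (E z) by exact: atom_measurable.
pose h w := \sum_(z : I) phi z.1 z.2 * \1_(E z) w.
have hq w : (2 <= r w <= T.+1)%N -> f w = h w.
  move=> /andP[_ rT]; pose z0 : I := (history w, Ordinal (rT : r w < T.+2)%N).
  rewrite /h (bigD1 z0) //= big1 => [|z zz0].
    by rewrite fphi indicE mem_set //= mulr1 addr0.
  rewrite indicE memNset ?mulr0 // => -[e1 e2]; move/eqP: zz0; apply.
  by case: z e1 e2 => A m /= <- e2; congr (_, _); exact: val_inj.
have mq a : measurable [set w | (history w, r w) = a].
  case: a => A m; rewrite (_ : [set w | _] = [set w | history w = A /\ r w = m]).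
    exact: atom_measurable.
  by apply/seteqP; split=> w /= [-> ->].
have ff : measurable_fun setT (fun w => (f w)%:E).
  by apply: (measurable_factor mq) => w w' [e1 e2]; rewrite !fphi e1 e2.
have fh : measurable_fun setT (fun w => (h w)%:E).
  apply: (measurable_factor mq) => w w' [e1 e2]; congr _%:E; apply: eq_bigr => z _.
  by rewrite !indicE; congr (_ * (_ : bool)%:R); apply/idP/idP; rewrite !inE /E /= e1 e2.
rewrite (ae_eq_integral (fun w => (h w)%:E)) //; last first.
  by apply: filterS index_in_range => w rw _ /=; rewrite hq.
rewrite /h integral_simple //; congr _%:E.
rewrite -(pair_bigA _ (fun A (m : 'I_T.+2) => phi A m * fine (P (E (A, m))))) /=.
apply: eq_bigr => A _; rewrite -sum_index_weight mulr_sumr; apply: eq_bigr => m _.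
by rewrite /E /= atom_prob /=; ring.
Qed.

Lemma le_integral_history (g : Omega -> \bar R) (f : Omega -> R)
    (phi : {ffun 'I_N -> {set 'I_n}} -> nat -> R) :
  (forall w, 0 <= g w)%E ->
  (forall w, 0 <= f w) ->
  (forall w, f w = phi (history w) (r w)) ->
  (forall w, (2 <= r w <= T.+1)%N -> g w <= (f w)%:E)%E ->
  (\int[P]_w g w <=
   (\sum_A history_weight A * (T%:R^-1 * \sum_(2 <= m < T.+2) phi A m))%:E)%E.
Proof.
move=> g0 f0 fphi gf; rewrite -(integral_history fphi).
(* Nothing is known of [g] outside the range of the index, so it is dominated there by [+oo] on a
   null set. *)
pose h w : \bar R := if (2 <= r w <= T.+1)%N then (f w)%:E else +oo%E.
have mq a : measurable [set w | (history w, r w) = a].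
  case: a => A m; rewrite (_ : [set w | _] = [set w | history w = A /\ r w = m]).
    exact: atom_measurable.
  by apply/seteqP; split=> w /= [-> ->].
apply: (@le_trans _ _ (\int[P]_w h w)%E).
  by apply: ge0_le_integral_nomeas => // w; rewrite /h; case: ifP => [/gf//|_]; rewrite leey.
rewrite (ae_eq_integral (fun w => (f w)%:E)) //.
- by apply: (measurable_factor mq) => w w' [e1 e2]; rewrite /h !fphi e1 e2.
- by apply: (measurable_factor mq) => w w' [e1 e2]; rewrite !fphi e1 e2.
- by apply: filterS index_in_range => w rw _ /=; rewrite /h rw.
Qed.

(** A history of positive weight has positive probability and cannot lie inside the null complement
    of [good]. Histories of zero weight are still represented whenever they occur, which allows a
    pointwise comparison on all of [Omega]. *)
Lemma history_representative (good : set Omega) : {ae P, forall w, good w} ->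
  exists rep : {ffun 'I_N -> {set 'I_n}} -> Omega,
    (forall w, history (rep (history w)) = history w) /\
    (forall A, history_weight A != 0 -> history (rep A) = A /\ good (rep A)).
Proof.
move=> goodae.
have pos A : history_weight A != 0 -> exists w, history w = A /\ good w.
  move=> A0; apply: contrapT => no.
  (* Any index value of positive probability would serve; 2 is one, because [T] is positive. *)
  have : P.-negligible [set w | history w = A /\ r w = 2].
    by apply: negligibleS goodae => w /= [hA _] gw; apply: no; exists w.
  move=> /(negligibleP _ (atom_measurable A 2)) h0.
  have /eqP := etrans (esym (atom_prob A 2)) h0.
  rewrite eqe mulf_eq0 (negbTE A0) /index_weight /= ltnS T_gt0 invr_eq0 pnatr_eq0.
  by rewrite eqn0Ngt T_gt0.
have ex A : exists w, (forall w', history w' = A -> history w = A) /\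
    (history_weight A != 0 -> history w = A /\ good w).
  have [A0|A0] := eqVneq (history_weight A) 0.
    have [[w hw]|no] := pselect (exists w, history w = A); first by exists w.
    by exists point; split => // w hw; case: no; exists w.
  by have [w [hA gw]] := pos A A0; exists w.
have [rep repP] := choice ex.
exists rep; split=> [w|A]; first exact: (repP _).1 w erefl.
exact: (repP A).2.
Qed.
End FiniteHistories.

(** * The momentum error *)

Lemma batch_centered {R : realType} {V : lmodType R} {n : nat} (C : {set 'I_n})
    (v : 'I_n -> V) (g : V) : (0 < #|C|)%N ->
  #|C|%:R^-1 *: \sum_(j in C) v j - g = #|C|%:R^-1 *: \sum_(j in C) (v j - g).
Proof.
move=> C0; rewrite sumrB sumr_const scalerBr -[g *+ _]scaler_nat scalerA.
by rewrite mulVf ?scale1r // pnatr_eq0 -lt0n.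
Qed.

Lemma momentum_error {R : realType} {V : lmodType R} (a : R) (D D' G G' g g' : V) :
  D' = G' + (1 - a) *: (D - G) ->
  D' - g' = (1 - a) *: (D - g) + ((G' - g') - (1 - a) *: (G - g)).
Proof.
have -> : D - G = (D - g) - (G - g) by rewrite opprB addrA subrK.
move=> ->; rewrite scalerBr; move: (_ *: (D - g)) (_ *: (G - g)) => u w.
by rewrite [in RHS]addrCA !addrA (addrAC _ (- w)) (addrAC G').
Qed.

Lemma batch_combination {R : realType} {V : lmodType R} {n : nat} (C : {set 'I_n})
    (c t : R) (u v : 'I_n -> V) :
  c *: \sum_(j in C) u j - t *: (c *: \sum_(j in C) v j) =
  c *: \sum_(j in C) (u j - t *: v j).
Proof. by rewrite sumrB -scaler_sumr scalerBr !scalerA (mulrC t). Qed.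

Section SamplePaths.
Context {R : realType} {X : normedModType R} {n d : nat}.
Variable p : problem X n d.
Hypothesis std : standing p.
Local Notation MB := 'M[R]_(n, d).
Local Notation Hip := (dotX_inner_product p).
Opaque grad gradx_F gradB_F gradx_Fi.

(** The direction [D k] uses batch [k], while [x k], [B k] and [L k] use only earlier ones: hence
    the range up to [N.+1] and the restriction [k <= N] on [D]. *)
Lemma paths_agree (eta_ rho_ : nat -> R) (tau : R) (S S' : nat -> {set 'I_n})
    (x1 : X) (B1 L1 : MB) (x x' D D' : nat -> X) (B B' L L' : nat -> MB) (N : nat) :
  0 < tau ->
  DualHash_StoRM p eta_ rho_ tau S x1 B1 L1 x D B L ->
  DualHash_StoRM p eta_ rho_ tau S' x1 B1 L1 x' D' B' L' ->
  (forall k, (1 <= k <= N)%N -> S k = S' k) ->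
  forall k, (1 <= k <= N.+1)%N ->
  [/\ x k = x' k, B k = B' k, L k = L' k & (k <= N)%N -> D k = D' k].
Proof.
move=> tau0 a a' SS; elim=> [//|[_ _|k IH kN]].
  have e1 : x 1%N = x' 1%N by rewrite (alg_x1 a) (alg_x1 a').
  have e2 : B 1%N = B' 1%N by rewrite (alg_B1 a) (alg_B1 a').
  split => //; first by rewrite (alg_L1 a) (alg_L1 a').
  by move=> N1; rewrite (alg_D1 a) (alg_D1 a') SS // e1 e2.
have kN' : (k < N)%N by [].
have [ex eB eL eD] := IH (ltnW kN).
have ex' : x k.+2 = x' k.+2 by rewrite (alg_x a) // (alg_x a') // ex eD.
have eB' : B k.+2 = B' k.+2.
  have h : B k.+2 = _ := alg_B a (isT : (1 <= k.+1)%N).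
  have h' : B' k.+2 = _ := alg_B a' (isT : (1 <= k.+1)%N).
  by rewrite h h' ex' eB eL.
split => //.
  apply: (L_update_unique std tau0 (alg_L a (isT : (1 <= k.+1)%N))).
  by rewrite eB eB' eL; exact: (alg_L a').
move=> kN2; have h := alg_D a (isT : (1 <= k.+1)%N).
have h' := alg_D a' (isT : (1 <= k.+1)%N).
rewrite -(SS k.+2) // -ex' -eB' in h'.
rewrite -ex -eB -eD // in h'.
exact: etrans h (esym h').
Qed.

Lemma batch_noise (C : {set 'I_n}) y A : (0 < #|C|)%N ->
  batch_grad p C y A - gradx_F p y A = #|C|%:R^-1 *: \sum_(j in C) noise p j y A.
Proof.
exact: batch_centered.
Qed.

Lemma err_first (eta_ rho_ : nat -> R) (tau : R) (S : nat -> {set 'I_n})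
    (x1 : X) (B1 L1 : MB) (x D : nat -> X) (B L : nat -> MB) :
  DualHash_StoRM p eta_ rho_ tau S x1 B1 L1 x D B L -> (0 < #|S 1%N|)%N ->
  err p x D B 1 = #|S 1%N|%:R^-1 *: \sum_(j in S 1%N) noise p j x1 B1.
Proof.
move=> a C0; apply: etrans (batch_noise x1 B1 C0).
have h1 := alg_D1 a; rewrite (alg_x1 a) (alg_B1 a) in h1.
by rewrite /err h1 (alg_x1 a) (alg_B1 a).
Qed.

Lemma err_next (eta_ rho_ : nat -> R) (tau : R) (S : nat -> {set 'I_n})
    (x1 : X) (B1 L1 : MB) (x D : nat -> X) (B L : nat -> MB) (k : nat) :
  DualHash_StoRM p eta_ rho_ tau S x1 B1 L1 x D B L ->
  (1 <= k)%N -> (0 < #|S k.+1|)%N ->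
  err p x D B k.+1 = (1 - rho_ k) *: err p x D B k + #|S k.+1|%:R^-1 *:
    \sum_(j in S k.+1) (noise p j (x k.+1) (B k.+1) - (1 - rho_ k) *: noise p j (x k) (B k)).
Proof.
move=> a k1 C0; apply: etrans (momentum_error (gradx_F p (x k) (B k))
  (gradx_F p (x k.+1) (B k.+1)) (alg_D a k1)) _.
rewrite (batch_noise (x k.+1) (B k.+1) C0) (batch_noise (x k) (B k) C0).
by rewrite batch_combination.
Qed.

Variables (sigma2 LF : R).
Hypothesis unb : unbiased_bounded_variance p sigma2.
Hypothesis mss : mean_square_smooth p LF.

(** Write [v] as [a] times the new noise plus [1 - a] times a noise difference. The first part is
    small through [a], the second through the length of the [x]-step. *)
Lemma momentum_noise_variance (a : R) y y' A A' (v : 'I_n -> X) : 0 <= a <= 1 ->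
  (forall i, v i = noise p i y' A' - (1 - a) *: noise p i y A) ->
  mean (fun i => dotX p (v i) (v i) : R^o)
    <= 2 * a ^+ 2 * sigma2 + 2 * LF ^+ 2 * `|y' - y| ^+ 2.
Proof.
move=> /andP[a0 a1] vdef.
have vE i : v i = a *: noise p i y' A' + (1 - a) *: (noise p i y' A' - noise p i y A).
  rewrite vdef; move: (noise p i y' A') (noise p i y A) => u w.
  by rewrite scalerBr addrA -scalerDl (addrC a) subrK scale1r.
have h1 := noise_variance unb y' A'.
have h2 := noise_diff_variance std unb mss y' y A' A.
have le i : dotX p (v i) (v i) <= 2 * a ^+ 2 * `|noise p i y' A'| ^+ 2 +
    2 * `|noise p i y' A' - noise p i y A| ^+ 2.
  have := ip_sqD_le2 Hip (a *: noise p i y' A') ((1 - a) *: (noise p i y' A' - noise p i y A)).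
  rewrite -vE => h; apply: le_trans h _.
  rewrite !(norm_dotX std).
  move: (noise p i y' A') (noise p i y' A' - noise p i y A) => u w.
  have sqZ c z : dotX p (c *: z) (c *: z) = c ^+ 2 * dotX p z z.
    by rewrite (ipZl Hip) (ipZr Hip); ring.
  rewrite !sqZ mulrA lerD2l ler_pM2l // -[leRHS]mul1r ler_wpM2r ?(ip_ge0 Hip) //.
  by rewrite expr_le1 ?subr_ge0 // lerBlDr lerDl.
move: h1 h2; rewrite !mean_realE => h1 h2.
have inv0 : 0 <= n%:R^-1 :> R by rewrite invr_ge0 ler0n.
apply: le_trans (ler_wpM2l inv0 (ler_sum _ (fun i _ => le i))) _.
rewrite big_split /= -!mulr_sumr mulrDr.
rewrite (mulrCA _ (2 * a ^+ 2)) (mulrCA _ 2) -mulrA.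
have a2 : 0 <= 2 * a ^+ 2 by rewrite mulr_ge0 // sqr_ge0.
have := ler_wpM2l a2 h1; lra.
Qed.
End SamplePaths.

(** * Rate from the averaged recursions *)

Section Rate.
Context {R : realType}.

(** Sum both recursions over [1 <= k <= T + 1] and eliminate the total error. With [h] of order
    [1 / t] and [a] of order [1 / t^2], the accumulated variance contributes a quantity free of [T],
    the first error too because the first batch has size of order [t]. *)
Lemma storm_rate (T : nat) (t eta rho Lt LF kappa A1 A2 s2 cb b psistar h a : R)
    (psi g q e DB : nat -> R) :
  1 <= t -> t ^+ 3 = T%:R -> 0 < eta <= 2^-1 -> 1 <= rho -> 8 * rho * eta ^+ 2 <= 1 ->
  0 < LF <= Lt -> 0 < kappa -> 0 <= A1 -> 0 <= A2 -> 0 <= s2 -> 0 < cb -> 1 <= b ->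
  h = eta / (Lt * t) -> a = 8 * rho * eta ^+ 2 / t ^+ 2 ->
  (forall k, 0 <= g k) -> (forall k, 0 <= q k) -> (forall k, 0 <= e k) ->
  (forall k, 0 <= DB k) ->
  (forall k, (1 <= k < T.+2)%N -> psi k.+1 <= psi k - h / 2 * g k
    - h / 2 * (1 - Lt * h) * q k + h / 2 * e k - kappa * (DB k.+1 + DB k)) ->
  (forall k, (1 <= k < T.+2)%N -> e k.+1 <= (1 - a) ^+ 2 * e k
    + (2 * a ^+ 2 * s2 + 2 * LF ^+ 2 * (h ^+ 2 * q k)) / b) ->
  e 1%N <= s2 / (cb * t) ->
  psistar <= psi T.+2 ->
  \sum_(2 <= k < T.+2) (g k + A1 * (h ^+ 2 * q k) + A2 * (2 * DB k.+1 + 2 * DB k))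
  <= (2 * Lt / eta + 8 * A1 * eta / Lt + 2 * A2 / kappa) * t *
     (psi 1%N - psistar + eta / Lt *
        (s2 / (4 * rho * eta ^+ 2 * cb) + 32 * rho * eta ^+ 2 * s2 / b)).
Proof.
move=> t1 t3 /andP[eta0 eta2] rho1 rhoeta /andP[LF0 LFLt] kappa0 A10 A20 s20 cb0 b1
  hE aE g0 q0 e0 DB0 I1 I2 I3 I4.
have t0 : 0 < t by lra.
have Lt0 : 0 < Lt by lra.
have rho0 : 0 < rho by lra.
have b0 : 0 < b by lra.
have h0 : 0 < h by rewrite hE divr_gt0 ?mulr_gt0.
have a0 : 0 < a by rewrite aE !(divr_gt0, mulr_gt0, exprn_gt0).
have ht : h * t = eta / Lt by rewrite hE; field; rewrite !gt_eqF.
have Lth : Lt * h <= 2^-1.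
  have -> : Lt * h = eta / t by rewrite hE; field; rewrite !gt_eqF.
  by rewrite ler_pdivrMr //; nra.
have a1 : a <= 1.
  by rewrite aE ler_pdivrMr ?exprn_gt0 // mul1r (le_trans rhoeta) // exprn_ege1.
have aEh : a = 8 * rho * Lt ^+ 2 * h ^+ 2 by rewrite aE hE; field; rewrite !gt_eqF.
(* The factor 8 of the momentum and [1 <= rho] are spent here: the [x]-steps feeding the error
   return at most [h / 8 * SQ], half of the [h / 4 * SQ] secured by [Lt * h <= 1/2]. *)
have LFa : 8 * (LF ^+ 2 * h ^+ 2) <= a.
  have h1 : LF ^+ 2 <= Lt ^+ 2 by rewrite ler_pXn2r ?nnegrE // ltW.
  have h2 : Lt ^+ 2 <= rho * Lt ^+ 2 by rewrite ler_peMl // sqr_ge0.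
  rewrite aEh -!(mulrA 8) ler_pM2l // ler_pM2r ?exprn_gt0 //; exact: le_trans h1 h2.
pose SG := \sum_(1 <= k < T.+2) g k.
pose SQ := \sum_(1 <= k < T.+2) q k.
pose SE := \sum_(1 <= k < T.+2) e k.
pose SB := \sum_(1 <= k < T.+2) (DB k.+1 + DB k).
have SG0 : 0 <= SG by apply: sumr_ge0 => k _.
have SQ0 : 0 <= SQ by apply: sumr_ge0 => k _.
have SB0 : 0 <= SB by apply: sumr_ge0 => k _; exact: addr_ge0.
have tel1 : h / 2 * SG + h / 2 * (1 - Lt * h) * SQ + kappa * SB
    <= psi 1%N - psistar + h / 2 * SE.
  have : \sum_(1 <= k < T.+2) (h / 2 * g k + h / 2 * (1 - Lt * h) * q k
      + kappa * (DB k.+1 + DB k) - h / 2 * e k)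
      <= \sum_(1 <= k < T.+2) (- psi k.+1 - - psi k).
    rewrite !big_nat; apply: ler_sum => k kT; have := I1 k kT; lra.
  rewrite telescope_sumr // sumrB !big_split /= -!mulr_sumr -/SG -/SQ -/SE -/SB; lra.
have tel2 : a * SE <= s2 / (cb * t) + 2 * T%:R * (2 * a ^+ 2 * s2 / b)
    + 2 * (LF ^+ 2 * h ^+ 2) * SQ.
  have : \sum_(1 <= k < T.+2) (a * e k) <= \sum_(1 <= k < T.+2)
      ((- e k.+1 - - e k) + 2 * a ^+ 2 * s2 / b + 2 * (LF ^+ 2 * h ^+ 2) * q k).
    rewrite !big_nat; apply: ler_sum => k kT; have := I2 k kT.
    have c0 : 0 <= 2 * (LF ^+ 2 * h ^+ 2) * q k.
      by apply: mulr_ge0 => //; apply: mulr_ge0 => //; apply: mulr_ge0; exact: sqr_ge0.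
    have : 2 * (LF ^+ 2 * h ^+ 2) * q k / b <= 2 * (LF ^+ 2 * h ^+ 2) * q k.
      by rewrite ler_pdivrMr // ler_peMr.
    have : (1 - a) ^+ 2 * e k <= (1 - a) * e k.
      have a1' : 0 <= 1 - a by rewrite subr_ge0.
      have := mulr_ge0 (mulr_ge0 (ltW a0) a1') (e0 k); lra.
    lra.
  rewrite big_split /= big_split /= telescope_sumr // -!mulr_sumr -/SE -/SQ sumr_const_nat.
  rewrite subSS subn0 -[_ *+ T.+1]mulr_natl => h1.
  have e2 := e0 T.+2.
  have T1 : T.+1%:R <= 2 * T%:R :> R.
    rewrite -natr1; have : 1 <= T%:R :> R by rewrite -t3 exprn_ege1.
    lra.
  have v0 : 0 <= 2 * a ^+ 2 * s2 / b.
    by apply: divr_ge0 (ltW b0); do 2!apply: mulr_ge0 => //; exact: sqr_ge0.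
  have := ler_wpM2r v0 T1; lra.
have SEle : h / 2 * SE <= eta / Lt * (s2 / (16 * rho * eta ^+ 2 * cb)
     + 16 * rho * eta ^+ 2 * s2 / b) + h / 8 * SQ.
  rewrite -(ler_pM2l a0).
  have -> : a * (h / 2 * SE) = h / 2 * (a * SE) by ring.
  apply: le_trans (ler_wpM2l _ tel2) _; first by rewrite divr_ge0 // ltW.
  have x1 : h / 2 * (s2 / (cb * t)) = a * (eta / Lt * (s2 / (16 * rho * eta ^+ 2 * cb))).
    by rewrite hE aE; field; rewrite !gt_eqF.
  have x2 : h / 2 * (2 * T%:R * (2 * a ^+ 2 * s2 / b)) =
      a * (eta / Lt * (16 * rho * eta ^+ 2 * s2 / b)).
    by rewrite -t3 hE aE; field; rewrite !gt_eqF.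
  have x3 : h / 2 * (2 * (LF ^+ 2 * h ^+ 2) * SQ) <= a * (h / 8 * SQ).
    have -> : h / 2 * (2 * (LF ^+ 2 * h ^+ 2) * SQ) =
      (8 * (LF ^+ 2 * h ^+ 2)) * (h / 8 * SQ) by field.
    by rewrite ler_wpM2r // mulr_ge0 // divr_ge0 // ltW.
  lra.
pose G0 := psi 1%N - psistar + eta / Lt *
   (s2 / (4 * rho * eta ^+ 2 * cb) + 32 * rho * eta ^+ 2 * s2 / b).
have main : h / 2 * SG + h / 8 * SQ + kappa * SB <= G0.
  have u1 : h / 4 * SQ <= h / 2 * (1 - Lt * h) * SQ.
    by rewrite ler_wpM2r //; nra.
  have u2 : s2 / (16 * rho * eta ^+ 2 * cb) <= s2 / (4 * rho * eta ^+ 2 * cb).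
    rewrite ler_wpM2l // lef_pV2 ?posrE ?mulr_gt0 ?exprn_gt0 //.
    by rewrite ler_pM2r // ler_pM2r ?exprn_gt0 // ler_pM2r //; lra.
  have u3 : 16 * rho * eta ^+ 2 * s2 / b <= 32 * rho * eta ^+ 2 * s2 / b.
    rewrite ler_wpM2r ?invr_ge0 ?(ltW b0) // ler_wpM2r // ler_wpM2r ?sqr_ge0 //.
    by rewrite ler_pM2r //; lra.
  have c0 : 0 <= eta / Lt by rewrite divr_ge0 // ltW.
  have := ler_wpM2l c0 (lerD u2 u3); rewrite /G0; lra.
have hSQ0 : 0 <= h / 8 * SQ by rewrite mulr_ge0 // divr_ge0 // ltW.
have hSG0 : 0 <= h / 2 * SG by rewrite mulr_ge0 // divr_ge0 // ltW.
have kSB0 : 0 <= kappa * SB by rewrite mulr_ge0 // ltW.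
have G00 : 0 <= G0 by lra.
(* The recursions start at index 1 but the averaged index at 2; the nonnegative first term is
   added. *)
apply: (@le_trans _ _ (SG + A1 * (h ^+ 2 * SQ) + A2 * (2 * SB))).
  rewrite [X in _ <= X](_ : _ = \sum_(1 <= k < T.+2) (g k + A1 * (h ^+ 2 * q k)
    + A2 * (2 * DB k.+1 + 2 * DB k))).
    rewrite [X in _ <= X]big_ltn // lerDr /=; apply: addr_ge0.
      by apply: addr_ge0 => //; do 2!apply: mulr_ge0 => //; exact: sqr_ge0.
    by apply: mulr_ge0 => //; apply: addr_ge0; exact: mulr_ge0.
  rewrite !big_split /= -!mulr_sumr -/SG -/SQ; congr (_ + _ * _).
  by rewrite /SB big_split /= mulrDr !mulr_sumr big_split.
(* The three summands of the constant come from dividing [main] by [h / 2], [h / 8] and [kappa]; the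
   last two bounds are enlarged by powers of [t >= 1] to share the factor [t]. *)
have y1 : SG <= 2 * Lt / eta * t * G0.
  have -> : 2 * Lt / eta * t * G0 = 2 / h * G0 by rewrite hE; field; rewrite !gt_eqF.
  have -> : SG = 2 / h * (h / 2 * SG) by field; rewrite gt_eqF.
  by rewrite ler_wpM2l ?divr_ge0 ?(ltW h0) //; lra.
have y2 : A1 * (h ^+ 2 * SQ) <= 8 * A1 * eta / Lt * t * G0.
  have -> : 8 * A1 * eta / Lt * t * G0 = A1 * (8 * eta / Lt * t * G0) by ring.
  apply: ler_wpM2l => //.
  have -> : h ^+ 2 * SQ = 8 * h * (h / 8 * SQ) by field.
  have hle : h <= eta / Lt * t.
    by rewrite -ht -mulrA ler_peMr ?(ltW h0) // -expr2 exprn_ege1.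
  apply: (@le_trans _ _ (8 * h * G0)).
    by rewrite ler_wpM2l ?mulr_ge0 ?(ltW h0) //; lra.
  by rewrite ler_wpM2r // -!mulrA ler_pM2l // mulrA.
have y3 : A2 * (2 * SB) <= 2 * A2 / kappa * t * G0.
  have -> : 2 * A2 / kappa * t * G0 = A2 * (2 * (t * (kappa^-1 * G0))) by ring.
  apply: ler_wpM2l => //; rewrite ler_pM2l //.
  have z : SB <= kappa^-1 * G0 by rewrite mulrC ler_pdivlMr // mulrC; lra.
  by apply: le_trans z _; rewrite ler_peMl // mulr_ge0 // invr_ge0 ltW.
by rewrite -/G0; apply: le_trans (lerD (lerD y1 y2) y3) _; rewrite !mulrDl.
Qed.

Lemma powR_cube_root (T : nat) : (T%:R `^ (3^-1) : R) ^+ 3 = T%:R.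
Proof. by rewrite -powR_mulrn ?powR_ge0 // -powRrM mulVf ?pnatr_eq0 // powRr1. Qed.

Lemma powR_cube_root_ge1 (T : nat) : (0 < T)%N -> (1 : R) <= T%:R `^ (3^-1).
Proof.
move=> T0; rewrite -[leLHS](@powRr0 _ T%:R); apply: ler_powR; last by rewrite invr_ge0.
by rewrite ler1n.
Qed.

Lemma powR_two_thirds (T : nat) : (T%:R `^ (2 / 3) : R) = (T%:R `^ (3^-1)) ^+ 2.
Proof. by rewrite -powR_mulrn ?powR_ge0 // -powRrM mulrC. Qed.

Lemma le_sq_of_powR (G eps t : R) : 0 <= G -> 0 < eps -> 0 < t ->
  G `^ (3 / 2) / eps ^+ 3 <= t ^+ 3 -> G / t ^+ 2 <= eps ^+ 2.
Proof.
move=> G0 eps0 t0; rewrite ler_pdivrMr ?exprn_gt0 // ler_pdivrMr ?exprn_gt0 // => h.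
rewrite leNgt; apply/negP => lt; move: h; apply/negP; rewrite -ltNge.
have -> : t ^+ 3 * eps ^+ 3 = (eps ^+ 2 * t ^+ 2) `^ (3 / 2).
  rewrite -!exprMn (mulrC t) -[X in X `^ _]powR_mulrn ?mulr_ge0 ?ltW //.
  rewrite -powRrM -powR_mulrn ?mulr_ge0 ?ltW //; congr (_ `^ _); by field.
have et0 : eps ^+ 2 * t ^+ 2 \is Num.nneg by rewrite nnegrE mulr_ge0 ?sqr_ge0.
by apply: (gt0_ltr_powR _ et0 G0 lt); rewrite divr_gt0.
Qed.
End Rate.

(** * The momentum error averaged over batch histories *)

Section ErrorRecursion.
Context {R : realType} {X : normedModType R} {n d : nat}.
Variable p : problem X n d.
Hypothesis std : standing p.
Local Notation MB := 'M[R]_(n, d).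
Local Notation Hip := (dotX_inner_product p).
Opaque grad gradx_F gradB_F gradx_Fi.
Variables (sigma2 LF tau : R).
Hypothesis unb : unbiased_bounded_variance p sigma2.
Hypothesis mss : mean_square_smooth p LF.
Hypothesis tau_gt0 : 0 < tau.
Context {Omega : Type}.
Variables (eta_ rho_ : nat -> R) (S : nat -> Omega -> {set 'I_n}) (bs : nat -> nat).
Variables (x1 : X) (B1 L1 : MB) (x D : Omega -> nat -> X) (B L : Omega -> nat -> MB).
Hypothesis path : forall w, DualHash_StoRM p eta_ rho_ tau (fun k => S k w) x1 B1 L1
  (x w) (D w) (B w) (L w).
Variable N : nat.
Hypothesis bs_le : forall k, (bs k <= n)%N.
Local Notation history_type := {ffun 'I_N -> {set 'I_n}}.
Local Notation hw := (history_weight (R := R) bs).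
Variable rep : history_type -> Omega.
Hypothesis repK : forall A, hw A != 0 ->
  forall i : 'I_N, S (val i).+1 (rep A) = A i.

(** Only representatives of histories of positive weight matter. For functions determined by the
    history this is the integral against the sampling law. *)
Definition expectation (f : Omega -> R) : R :=
  \sum_(A : history_type) hw A * f (rep A).

Let w1 (i : 'I_N) : \sum_(c : {set 'I_n}) batch_weight (bs (val i).+1) c = 1 :> R.
Proof. exact: sum_batch_weight. Qed.

Lemma history_weight_ge0 (A : history_type) : 0 <= hw A.
Proof. by apply: (prodr_ge0 (R := R)) => i _; exact: batch_weight_ge0. Qed.

Lemma le_expectation (f g : Omega -> R) :
  (forall A, hw A != 0 -> f (rep A) <= g (rep A)) ->
  expectation f <= expectation g.
Proof.
move=> fg; apply: ler_sum => A _.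
have [->|A0] := eqVneq (hw A) 0; first by rewrite !mul0r.
by rewrite ler_wpM2l ?history_weight_ge0 // fg.
Qed.

Lemma expectation_cst (c : R) : expectation (fun=> c) = c.
Proof. by rewrite /expectation -mulr_suml sum_product_weight // mul1r. Qed.

Lemma expectationD (f g : Omega -> R) :
  expectation (fun w => f w + g w) = expectation f + expectation g.
Proof. by rewrite /expectation -big_split; apply: eq_bigr => A _; rewrite mulrDr. Qed.

Lemma expectationZ (c : R) (f : Omega -> R) :
  expectation (fun w => c * f w) = c * expectation f.
Proof. by rewrite /expectation mulr_sumr; apply: eq_bigr => A _; rewrite mulrCA. Qed.

Lemma expectation_affine (c c' c'' b : R) (f g : Omega -> R) :
  expectation (fun w => c * f w + (c' + c'' * g w) / b) =
  c * expectation f + (c' + c'' * expectation g) / b.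
Proof.
rewrite -[in RHS](expectation_cst c') -!expectationZ -expectationD mulrC -expectationZ.
by rewrite -expectationD /expectation; apply: eq_bigr => A _; rewrite (mulrC b^-1).
Qed.

Lemma expectation_ge0 (f : Omega -> R) : (forall w, 0 <= f w) -> 0 <= expectation f.
Proof. by move=> f0; apply: sumr_ge0 => A _; rewrite mulr_ge0 ?history_weight_ge0. Qed.

(* The batch [i.+1] is averaged with all other batches fixed. *)
Lemma expectation_resample (i : 'I_N) (f g : Omega -> R) :
  (forall A, hw A != 0 ->
    \sum_c batch_weight (bs (val i).+1) c * f (rep (resample A i c)) <= g (rep A)) ->
  expectation f <= expectation g.
Proof.
move=> fg; rewrite /expectation /history_weight.
rewrite (sum_resample w1 i (fun A => f (rep A))); apply: ler_sum => A _.
rewrite -/(hw A); have [->|A0] := eqVneq (hw A) 0; first by rewrite !mul0r.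
by apply: ler_wpM2l; [exact: history_weight_ge0 | exact: fg].
Qed.

Lemma resample_weight (A : history_type) i c : hw A != 0 ->
  batch_weight (R := R) (bs (val i).+1) c != 0 ->
  hw (resample A i c) != 0.
Proof.
move=> A0 c0; have := product_weight_resample
  (fun i : 'I_N => batch_weight (R := R) (bs (val i).+1)) A i c.
move=> e; apply/negP => /eqP h; move: e; rewrite [X in X * _]h mul0r => /esym/eqP.
by rewrite mulf_eq0 -/(hw A) (negbTE A0) (negbTE c0).
Qed.

Lemma batch_weight_card m (c : {set 'I_n}) : batch_weight (R := R) m c != 0 -> #|c| = m.
Proof. by rewrite /batch_weight; have [//|_] := eqVneq #|c| m; rewrite eqxx. Qed.

Lemma err_first_le b : (0 < N)%N -> (0 < b)%N -> bs 1 = minn n b ->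
  expectation (fun w => `|err p (x w) (D w) (B w) 1| ^+ 2) <= sigma2 / b%:R.
Proof.
move=> N0 b0 bs1; rewrite -[leRHS]expectation_cst.
apply: (@expectation_resample (Ordinal N0)) => A A0 /=; rewrite bs1.
have n0 := std_n std.
have vK : mean (fun j => dotX p (noise p j x1 B1) (noise p j x1 B1) : R^o) <= sigma2.
  apply: le_trans (noise_variance unb x1 B1); rewrite !mean_realE.
  rewrite ler_wpM2l ?invr_ge0 ?ler0n //; apply: ler_sum => i _.
  by rewrite (norm_dotX std).
have := batch_shift_variance Hip 0 n0 b0 (sum_noise std unb x1 B1) vK.
rewrite (ip0l Hip 0) add0r; apply: le_trans.
apply: ler_sum => c _; have [->|c0] := eqVneq (batch_weight (R := R) (minn n b) c) 0.
  by rewrite !mul0r.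
have cA0 : hw (resample A (Ordinal N0) c) != 0.
  by apply: resample_weight => //; rewrite bs1.
have Sc : S 1 (rep (resample A (Ordinal N0) c)) = c.
  by have := repK cA0 (Ordinal N0); rewrite ffunE eqxx.
have cc : (0 < #|c|)%N by rewrite (batch_weight_card c0) leq_min n0 b0.
rewrite (err_first (path _)) ?Sc // (norm_dotX std) add0r.
exact: lexx.
Qed.

(** Resampling batch [k.+1] leaves [(1 - a) *: err k] fixed and adds a batch average of mean zero,
    so the two squares add. *)
Lemma err_step_le b k (a : R) : (0 < k < N)%N -> (0 < b)%N -> bs k.+1 = minn n b ->
  rho_ k = a -> 0 <= a <= 1 ->
  expectation (fun w => `|err p (x w) (D w) (B w) k.+1| ^+ 2) <=
  (1 - a) ^+ 2 * expectation (fun w => `|err p (x w) (D w) (B w) k| ^+ 2)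
  + (2 * a ^+ 2 * sigma2
     + 2 * LF ^+ 2 * expectation (fun w => `|x w k.+1 - x w k| ^+ 2)) / b%:R.
Proof.
move=> /andP[k0 kN] b0 bsk rk a01; pose i : 'I_N := Ordinal kN.
rewrite -expectation_affine.
have n0 := std_n std.
apply: (@expectation_resample i) => A A0 /=; rewrite bsk.
set w := rep A.
pose v j := noise p j (x w k.+1) (B w k.+1) - (1 - a) *: noise p j (x w k) (B w k).
have v0 : \sum_j v j = 0.
  rewrite /v sumrB -scaler_sumr (sum_noise std unb (x w k.+1)).
  by rewrite (sum_noise std unb (x w k)) scaler0 subr0.
have vK := momentum_noise_variance std unb mss a01 (fun j => erefl (v j)).
have := batch_shift_variance Hip ((1 - a) *: err p (x w) (D w) (B w) k) n0 b0 v0 vK.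
have -> : dotX p ((1 - a) *: err p (x w) (D w) (B w) k)
    ((1 - a) *: err p (x w) (D w) (B w) k) =
    (1 - a) ^+ 2 * `|err p (x w) (D w) (B w) k| ^+ 2.
  by rewrite (norm_dotX std) (ipZl Hip) (ipZr Hip); ring.
apply: le_trans.
apply: ler_sum => c _; have [->|c0] := eqVneq (batch_weight (R := R) (minn n b) c) 0.
  by rewrite !mul0r.
have cA0 : hw (resample A i c) != 0.
  by apply: resample_weight => //; rewrite bsk.
set w' := rep (resample A i c).
have Sc : S k.+1 w' = c by have := repK cA0 i; rewrite ffunE eqxx.
(* The earlier batches are untouched, so by [paths_agree] the iterates up to [k.+1] and the
   direction [D k] are the same on both paths. *)
have Sj j : (1 <= j <= k)%N -> S j w' = S j w.
  case: j => // j /= jk; have jN : (j < N)%N := leq_trans jk (ltnW kN).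
  have := repK cA0 (Ordinal jN); rewrite ffunE -val_eqE /= ltn_eqF // => h.
  by rewrite /w' h; have := repK A0 (Ordinal jN).
have kk : (1 <= k <= k.+1)%N by rewrite k0 leqnSn.
have [ex eB _ eD] := paths_agree std tau_gt0 (path w') (path w) Sj kk.
have [ex' eB' _ _] := paths_agree std tau_gt0 (path w') (path w) Sj
  (leqnn k.+1 : (1 <= k.+1 <= k.+1)%N).
have cc : (0 < #|c|)%N by rewrite (batch_weight_card c0) leq_min n0 b0.
have errE : err p (x w') (D w') (B w') k = err p (x w) (D w) (B w) k.
  by rewrite /err ex eB eD.
rewrite (err_next (path w') k0) ?Sc // rk errE ex eB ex' eB' (norm_dotX std).
exact: lexx.
Qed.
End ErrorRecursion.

(** * From the sampling law to the rate *)

Section ConvergenceRate.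
Context {R : realType} {X : normedModType R} {n d : nat}.
Variable p : problem X n d.
Local Notation MB := 'M[R]_(n, d).
Opaque grad gradx_F gradB_F gradx_Fi.

Lemma dist_bound_ge0 (LF tau : R) (x : nat -> X) (B : nat -> MB) k :
  0 <= dist_bound p LF tau x B k.
Proof.
have Hfr := @frob_inner_product R n d.
have B0 j : 0 <= 2 * Delta_B B j by rewrite mulr_ge0 // divr_ge0 // (ip_ge0 Hfr).
have x0 j : 0 <= 2 * Delta_x x j by rewrite mulr_ge0 // divr_ge0 // sqr_ge0.
have s2 (c : R) : 0 <= 2 * c ^+ 2 by rewrite mulr_ge0 // sqr_ge0.
have s3 : 0 <= 2 * tau ^+ 2 * LF ^+ 2 by rewrite mulr_ge0 // sqr_ge0.
apply: addr_ge0; first apply: addr_ge0; first exact: sqr_ge0.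
  by apply: mulr_ge0 => //; apply: addr_ge0.
apply: mulr_ge0; last exact: addr_ge0.
by do 2?apply: addr_ge0 => //; rewrite divr_ge0 // sqr_ge0.
Qed.

Hypothesis std : standing p.
Variables (sigma2 LF tau delta eta rho cb : R) (b : nat).
Variables (x1 : X) (B0 B1 L1 : MB) (Psistar : R).
Hypothesis unb : unbiased_bounded_variance p sigma2.
Hypothesis mss : mean_square_smooth p LF.
Hypothesis tau_gt0 : 0 < tau.
Hypothesis delta_gt0 : 0 < delta.
Hypothesis index0 : index0_point p tau x1 B0 B1 L1.
Let kappa := (K2 LF tau delta - K1 tau delta - K3 LF tau delta) / 2.
Hypothesis kappa_gt0 : 0 < kappa.
Hypothesis eta_bound : 0 < eta <= 2^-1.
Hypothesis rho_ge1 : 1 <= rho.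
Hypothesis rho_eta : 8 * rho * eta ^+ 2 <= 1.
Hypothesis cb_gt0 : 0 < cb.
Hypothesis b_gt0 : (0 < b)%N.
Variables (T : nat) (disp : measure_display) (Omega : measurableType disp).
Variables (P : probability Omega R) (S : nat -> Omega -> {set 'I_n}) (r : Omega -> nat).
Variables (x D : Omega -> nat -> X) (B L : Omega -> nat -> MB).
Hypothesis T_gt0 : (0 < T)%N.
Let bs := batch_size n cb b T.
Hypothesis smp : uniform_sampling P bs T S r.
Hypothesis B_0 : forall w, B w 0%N = B0.
Hypothesis path : forall w, DualHash_StoRM p (step_size LF tau delta eta T)
  (momentum eta rho T) tau (fun k => S k w) x1 B1 L1 (x w) (D w) (B w) (L w).
Hypothesis Psi_lower : {ae P, forall w, forall k, (1 <= k)%N ->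
  (Psistar%:E <= Psi p LF tau delta (x w) (B w) (L w) k)%E}.

Let Lt := Ltilde LF tau delta.
Let t : R := T%:R `^ (3^-1).
Let h := step_size LF tau delta eta T 1.
Let a := momentum eta rho T 1.
Let A1 : R := 2 * LF ^+ 2 + 2 * tau ^+ 2 * LF ^+ 2.
Let A2 : R := 2 / tau ^+ 2 + 2 + 2 * tau ^+ 2 * LF ^+ 2.
(** The error recursion is used up to [k = T + 1], and the error at [T + 2] involves batch
    [T + 2]. *)
Let N := T.+2.

(** The initial gap without its nonpositive terms at the second iterate, the only ones through which
    the schedule, hence [T], enters. *)
Definition gap_bound : R :=
  F p x1 B1 + frob B1 L1 - fine (regconj p L1)
  + (K2 LF tau delta - K1 tau delta + K3 LF tau delta) / 2 * (frob2 (B1 - B0) / 2)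
  - Psistar.

Let gap := fine (\int[P]_w Psi p LF tau delta (x w) (B w) (L w) 1) - Psistar.

Lemma path_index0 w : index0_point p tau (x w 1%N) (B w 0%N) (B w 1%N) (L w 1%N).
Proof. by rewrite (alg_x1 (path w)) B_0 (alg_B1 (path w)) (alg_L1 (path w)). Qed.

Let x_step w k : (1 <= k)%N -> x w k.+1 = x w k - h *: D w k.
Proof. by move=> k1; rewrite (alg_x (path w) k1). Qed.

Let step_sq w k : (1 <= k)%N -> `|x w k.+1 - x w k| ^+ 2 = h ^+ 2 * `|D w k| ^+ 2.
Proof. by move=> k1; have := Delta_xE (@x_step w) k1; rewrite /Delta_x /=; lra. Qed.

Let PsiE w k : (1 <= k)%N -> Psi p LF tau delta (x w) (B w) (L w) k =
  (psi p LF tau delta (x w) (B w) (L w) k)%:E.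
Proof.
move=> k1.
exact: (PsiE std LF delta tau_gt0 (alg_B (path w)) (alg_L (path w)) (path_index0 w) k1).
Qed.

Let LF_gt0 : 0 < LF. Proof. by have [] := mss. Qed.

Let Lt_ge : 0 < LF <= Lt.
Proof.
rewrite LF_gt0 /Lt /Ltilde -addrA lerDl.
by rewrite addr_ge0 ?divr_ge0 ?mulr_ge0 ?(ltW tau_gt0) ?(ltW delta_gt0) ?(ltW LF_gt0).
Qed.

Let a01 : 0 <= a <= 1.
Proof. by have /andP[/ltW -> /ltW ->] := alg_rho (path point) (isT : (1 <= 1)%N). Qed.

Let bs_le k : (bs k <= n)%N. Proof. exact: geq_minl. Qed.

Section Representatives.
Variable rep : {ffun 'I_N -> {set 'I_n}} -> Omega.
Hypothesis rep_history : forall w, history S N (rep (history S N w)) = history S N w.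
Hypothesis repP : forall A, history_weight (R := R) bs A != 0 -> history S N (rep A) = A /\
  forall k, (1 <= k)%N ->
    (Psistar%:E <= Psi p LF tau delta (x (rep A)) (B (rep A)) (L (rep A)) k)%E.

Let repK A : history_weight (R := R) bs A != 0 ->
  forall i : 'I_N, S (val i).+1 (rep A) = A i.
Proof. by move=> /repP[hA _] i; rewrite -[in RHS]hA ffunE. Qed.

Let E (f : Omega -> R) : R := expectation bs rep f.
Let psi' k := E (fun w => psi p LF tau delta (x w) (B w) (L w) k).
Let g k := E (fun w => `|gradx_F p (x w k) (B w k)| ^+ 2).
Let q k := E (fun w => `|D w k| ^+ 2).
Let e k := E (fun w => `|err p (x w) (D w) (B w) k| ^+ 2).
Let DB k := E (fun w => Delta_B (B w) k).

Lemma expected_psi_step k : (1 <= k < T.+2)%N ->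
  psi' k.+1 <= psi' k - h / 2 * g k - h / 2 * (1 - Lt * h) * q k
    + h / 2 * e k - kappa * (DB k.+1 + DB k).
Proof.
move=> /andP[k1 _]; rewrite /psi' /g /q /e /DB /E /expectation.
rewrite -[in X in kappa * X]big_split /= !mulr_sumr -!sumrB -big_split /= -sumrB.
apply: ler_sum => A _; have h0 : 0 <= history_weight (R := R) bs A := history_weight_ge0 bs A.
have := psi_step std unb mss tau_gt0 delta_gt0 (@x_step (rep A))
  (alg_B (path (rep A))) (alg_L (path (rep A))) (path_index0 (rep A)) k1.
rewrite -/Lt -/kappa => /(ler_wpM2l h0).
move: (psi p LF tau delta _ _ _ k.+1) (psi p LF tau delta _ _ _ k)
  (`|gradx_F p _ _| ^+ 2) (`|D _ k| ^+ 2) (`|err p _ _ _ k| ^+ 2)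
  (Delta_B _ k.+1) (Delta_B _ k) (history_weight bs A).
by move=> *; lra.
Qed.

Lemma expected_err_step k : (1 <= k < T.+2)%N ->
  e k.+1 <= (1 - a) ^+ 2 * e k
    + (2 * a ^+ 2 * sigma2 + 2 * LF ^+ 2 * (h ^+ 2 * q k)) / b%:R.
Proof.
move=> kT; have /andP[k1 _] := kT.
have bsk : bs k.+1 = minn n b by rewrite /bs /batch_size eqSS gtn_eqF.
have -> : h ^+ 2 * q k = E (fun w => `|x w k.+1 - x w k| ^+ 2).
  rewrite /q /E -expectationZ; apply: eq_bigr => A _; congr (_ * _).
  by rewrite step_sq.
exact: (err_step_le std unb mss tau_gt0 path bs_le repK kT b_gt0 bsk erefl a01).
Qed.

Lemma expected_err_first : e 1%N <= sigma2 / (cb * t).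
Proof.
have t1 : 1 <= t := powR_cube_root_ge1 T_gt0.
have ct0 : 0 < cb * t by rewrite mulr_gt0 //; lra.
pose b1 := `|Num.ceil (cb * t)|%N.
have b1le : cb * t <= b1%:R.
  apply: le_trans (ceil_ge _) _; rewrite -[b1%:R]/((b1%:Z)%:~R) ler_int /b1 abszE.
  exact: ler_norm.
have b10 : (0 < b1)%N by rewrite -(ltr0n R) (lt_le_trans ct0).
have [s0 _] := unb.
apply: le_trans (err_first_le std unb path bs_le repK (isT : (0 < N)%N) b10 erefl) _.
by rewrite ler_wpM2l // lef_pV2 // posrE ltr0n.
Qed.

Lemma expected_psi_lower : Psistar <= psi' T.+2.
Proof.
rewrite -[leLHS](expectation_cst bs_le rep); apply: le_expectation => A A0.
by have [_ /(_ T.+2 isT)] := repP A0; rewrite PsiE // lee_fin.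
Qed.

Lemma history_agree w k : (1 <= k <= N.+1)%N -> let w' := rep (history S N w) in
  [/\ x w k = x w' k, B w k = B w' k, L w k = L w' k & (k <= N)%N -> D w k = D w' k].
Proof.
apply: (paths_agree std tau_gt0 (path w) (path _)) => j /andP[j1 jN].
case: j j1 jN => // j _ jN.
have := congr1 (fun A : {ffun 'I_N -> {set 'I_n}} => A (Ordinal jN)) (rep_history w).
by rewrite !ffunE.
Qed.

(** Only the iterates of index 0, 1 and 2 occur, and not the random index, so the average over that
    index collapses. *)
Lemma integral_Psi1 :
  (\int[P]_w Psi p LF tau delta (x w) (B w) (L w) 1 = (psi' 1)%:E)%E.
Proof.
under eq_integral do rewrite PsiE //.
rewrite (integral_history smp (N := N)
  (phi := fun A _ => psi p LF tau delta (x (rep A)) (B (rep A)) (L (rep A)) 1)).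
  congr _%:E; apply: eq_bigr => A _; rewrite sumr_const_nat subSS subn1 /=.
  by rewrite -[X in _^-1 * X]mulr_natl mulKf // pnatr_eq0 -lt0n.
move=> w; apply/eqP; rewrite -eqe -!PsiE //; apply/eqP.
have [ex eB eL _] := history_agree w (isT : (1 <= 1 <= N.+1)%N).
have [ex' eB' _ _] := history_agree w (isT : (1 <= 2 <= N.+1)%N).
by rewrite /Psi /Delta_B /Delta_x /= !B_0 ex eB eL ex' eB'.
Qed.

Lemma psi1_le : psi' 1 <= gap_bound + Psistar.
Proof.
rewrite -[leRHS](expectation_cst bs_le rep); apply: le_expectation => A _.
rewrite /psi /lagr (alg_x1 (path _)) (alg_B1 (path _)) (alg_L1 (path _)) /gap_bound subrK.
have Hfr := @frob_inner_product R n d.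
rewrite {2}/Delta_B /= B_0 (alg_B1 (path _)).
have k1 : 0 <= K1 tau delta * Delta_B (B (rep A)) 2.
  by rewrite mulr_ge0 ?divr_ge0 ?mulr_ge0 ?(ip_ge0 Hfr) // ltW.
have k4 : 0 <= K4 LF tau delta * Delta_x (x (rep A)) 2.
  rewrite mulr_ge0 ?divr_ge0 ?sqr_ge0 // mulr_ge0 ?sqr_ge0 //.
  by rewrite !mulr_ge0 // ltW.
lra.
Qed.

Lemma integral_dist_le :
  (\int[P]_w (dist0 (partial_Lag p (x w (r w)) (B w (r w)) (L w (r w))) ^+ 2)
   <= (T%:R^-1 * \sum_(2 <= m < T.+2)
        (g m + A1 * (h ^+ 2 * q m) + A2 * (2 * DB m.+1 + 2 * DB m)))%:E)%E.
Proof.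
pose phi A m := dist_bound p LF tau (x (rep A)) (B (rep A)) m.
apply: (@le_trans _ _
  (\sum_(A : {ffun 'I_N -> {set 'I_n}}) history_weight bs A *
    (T%:R^-1 * \sum_(2 <= m < T.+2) phi A m))%:E).
  apply: (le_integral_history smp (f := fun w => phi (history S N w) (r w))) => //.
  - by move=> w; rewrite expe2 mule_ge0 // dist0_ge0.
  - by move=> w; exact: dist_bound_ge0.
  move=> w /andP[r2 rT]; have r1 : (1 <= r w)%N by exact: ltnW.
  apply: le_trans (dist0_le std unb mss tau_gt0 (alg_B (path w)) (alg_L (path w))
    (path_index0 w) r1) _.
  have a1 : (1 <= r w <= N.+1)%N by rewrite r1 (leq_trans rT) // ltnW.
  have a2 : (1 <= (r w).+1 <= N.+1)%N by rewrite /= ltnS (leq_trans rT) // ltnW.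
  have a0 : (1 <= (r w).-1 <= N.+1)%N.
    by rewrite -ltnS prednK // r2 /= (leq_trans (leq_pred _)) // (leq_trans rT) // ltnW.
  have [ex eB _ _] := history_agree w a1.
  have [ex' eB' _ _] := history_agree w a2.
  have [_ eB0 _ _] := history_agree w a0.
  by rewrite lee_fin /phi /dist_bound /Delta_x /Delta_B /= ex eB ex' eB' eB0.
rewrite lee_fin le_eqVlt; apply/orP; left; apply/eqP.
under eq_bigr do rewrite mulrCA mulr_sumr.
rewrite -mulr_sumr exchange_big /=; congr (_ * _); rewrite !big_nat.
apply: eq_bigr => m /andP[m2 _]; have m1 : (1 <= m)%N by exact: ltnW.
rewrite /g /q /DB /E /expectation !mulr_sumr -[X in A2 * X]big_split /=.
rewrite mulr_sumr -!big_split /=.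
apply: eq_bigr => A _; rewrite /phi /dist_bound -/A1 -/A2.
by have := step_sq (rep A) m1; rewrite /Delta_x /= => ->; field.
Qed.

Lemma rate_of_representatives : [/\ 0 <= gap, gap <= gap_bound &
  (\int[P]_w (dist0 (partial_Lag p (x w (r w)) (B w (r w)) (L w (r w))) ^+ 2)
   <= ((2 * Lt / eta + 8 * A1 * eta / Lt + 2 * A2 / kappa) *
      (gap + eta / Lt * (sigma2 / (4 * rho * eta ^+ 2 * cb)
        + 32 * rho * eta ^+ 2 * sigma2 / b%:R)) / t ^+ 2)%:E)%E].
Proof.
have gapE : gap = psi' 1 - Psistar by rewrite /gap integral_Psi1.
have t1 : 1 <= t := powR_cube_root_ge1 T_gt0.
have t0 : 0 < t by lra.
split.
- rewrite gapE subr_ge0 -[leLHS](expectation_cst bs_le rep); apply: le_expectation => A A0.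
  by have [_ /(_ 1%N isT)] := repP A0; rewrite PsiE // lee_fin.
- by rewrite gapE lerBlDr; exact: psi1_le.
apply: le_trans integral_dist_le _; rewrite lee_fin.
have Hfr := @frob_inner_product R n d.
have [s0 _] := unb.
have LF2 : 0 <= LF ^+ 2 by exact: sqr_ge0.
have tau2 : 0 <= tau ^+ 2 by exact: sqr_ge0.
have tL : 0 <= tau ^+ 2 * LF ^+ 2 by exact: mulr_ge0.
have A10 : 0 <= A1 by rewrite /A1; lra.
have A20 : 0 <= A2.
  have : 0 <= (tau ^+ 2)^-1 by rewrite invr_ge0.
  rewrite /A2; lra.
have b1 : (1 : R) <= b%:R by rewrite ler1n.
have aE : a = 8 * rho * eta ^+ 2 / t ^+ 2 by rewrite /a /momentum powR_two_thirds.
have sq0 (f : Omega -> X) : 0 <= E (fun w => `|f w| ^+ 2).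
  by apply: expectation_ge0 => w; exact: sqr_ge0.
have g0 k : 0 <= g k by exact: sq0.
have q0 k : 0 <= q k by exact: sq0.
have e0 k : 0 <= e k by exact: sq0.
have DB0 k : 0 <= DB k.
  by apply: expectation_ge0 => w; rewrite divr_ge0 // (ip_ge0 Hfr).
have := storm_rate (psi := psi') t1 (powR_cube_root T) eta_bound rho_ge1 rho_eta
  Lt_ge kappa_gt0 A10 A20 s0 cb_gt0 b1 (erefl h) aE g0 q0 e0 DB0
  expected_psi_step expected_err_step expected_err_first expected_psi_lower.
rewrite -gapE -(powR_cube_root T) -/t => hsum.
rewrite mulrC ler_pdivrMr ?exprn_gt0 //; apply: le_trans hsum _.
have cancel (C G : R) : C * t * G = C * G / t ^+ 2 * t ^+ 3.
  by field; rewrite gt_eqF.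
by rewrite cancel.
Qed.
End Representatives.

Lemma rate : [/\ 0 <= gap, gap <= gap_bound &
  (\int[P]_w (dist0 (partial_Lag p (x w (r w)) (B w (r w)) (L w (r w))) ^+ 2)
   <= ((2 * Lt / eta + 8 * A1 * eta / Lt + 2 * A2 / kappa) *
      (gap + eta / Lt * (sigma2 / (4 * rho * eta ^+ 2 * cb)
        + 32 * rho * eta ^+ 2 * sigma2 / b%:R)) / t ^+ 2)%:E)%E].
Proof.
have [rep [rep_history repP]] := history_representative smp T_gt0 N Psi_lower.
exact: rate_of_representatives rep_history repP.
Qed.
End ConvergenceRate.

(** In terms of [s = tau * LF] the numerator decreases for positive [s] and still exceeds 3/2 at
    [s = 1/20]. *)
Lemma kappa_gt0 {R : realType} (LF tau : R) : 0 < LF -> 0 < tau -> tau * LF <= 20^-1 ->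
  0 < (K2 LF tau 20^-1 - K1 tau 20^-1 - K3 LF tau 20^-1) / 2.
Proof.
move=> LF0 tau0 tL; rewrite divr_gt0 //.
have -> : K2 LF tau 20^-1 - K1 tau 20^-1 - K3 LF tau 20^-1 =
  (2 - tau * LF - 3 / 20 * (1 + tau * LF) ^+ 2 - 3 / 20 - 20 * (tau * LF) ^+ 2) / tau.
  by rewrite /K1 /K2 /K3; field; rewrite gt_eqF.
rewrite divr_gt0 //; have : 0 < tau * LF by rewrite mulr_gt0.
move: (tau * LF) tL => s s1 s0; nra.
Qed.

(** Batches are capped at [n] and evaluated at most twice; [n] is among the constants held fixed as
    [eps] tends to 0. *)
Lemma sfo_calls_le (n : nat) (R : realType) (cb : R) (b T : nat) :
  (sfo_calls (batch_size n cb b T) T <= 2 * n * T)%N.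
Proof.
rewrite /sfo_calls; apply: (@leq_trans (\sum_(1 <= k < T.+1) 2 * n)).
  apply: leq_sum => k _; have bn : (batch_size n cb b T k <= n)%N by exact: geq_minl.
  by case: ifP => _; lia.
by rewrite sum_nat_const_nat subSS subn0 mulnC.
Qed.

Theorem theorem2 (R : realType) :
  exists delta c_delta : R, 0 < delta /\ 0 < c_delta /\
  forall LF eta rho tau : R,
  0 < LF ->
  0 < eta <= 2^-1 ->
  1 <= rho <= (8 * eta ^+ 2)^-1 ->
  0 < tau <= Num.sqrt (c_delta * delta ^+ 2) / LF ->
  exists L_Delta C_sigma : R, 0 < L_Delta /\ 0 < C_sigma /\
  forall (X : normedModType R) (n d : nat) (p : problem X n d)
    (sigma2 cb : R) (b : nat) (x1 : X) (B0 B1 L1 : 'M[R]_(n, d))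
    (Psistar : R),
  standing p ->
  bounded_below_J p ->
  unbiased_bounded_variance p sigma2 ->
  mean_square_smooth p LF ->
  0 < cb ->
  (1 <= b)%N ->
  index0_point p tau x1 B0 B1 L1 ->
  exists C eps0 : R, 0 < C /\ 0 < eps0 /\
  forall (eps : R) (T : nat)
    (disp : measure_display) (Omega : measurableType disp)
    (P : probability Omega R)
    (S : nat -> Omega -> {set 'I_n}) (r : Omega -> nat)
    (x D : Omega -> nat -> X) (B L : Omega -> nat -> 'M[R]_(n, d)),
  0 < eps ->
  (0 < T)%N ->
  uniform_sampling P (batch_size n cb b T) T S r ->
  (forall w, B w 0%N = B0) ->
  (forall w, DualHash_StoRM p (step_size LF tau delta eta T)
     (momentum eta rho T) tau (fun k => S k w) x1 B1 L1
     (x w) (D w) (B w) (L w)) ->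
  {ae P, forall w, bounded_iterates (x w) (B w) (L w)} ->
  {ae P, forall w, forall k, (1 <= k)%N ->
     (Psistar%:E <= Psi p LF tau delta (x w) (B w) (L w) k)%E} ->
  let gap := fine (\int[P]_w Psi p LF tau delta (x w) (B w) (L w) 1) - Psistar in
  T%:Z = Num.ceil
    ((L_Delta * gap
      + C_sigma * (sigma2 / (4 * rho * eta ^+ 2 * cb)
                   + 32 * rho * eta ^+ 2 * sigma2 / b%:R)) `^ (3 / 2)
     / eps ^+ 3) ->
  (\int[P]_w (dist0 (partial_Lag p (x w (r w)) (B w (r w)) (L w (r w))) ^+ 2)
     <= (eps ^+ 2)%:E)%E /\
  (eps < eps0 ->
     (sfo_calls (batch_size n cb b T) T)%:R <= C / eps ^+ 3).
Proof.
(* Any [delta] for which [tau * LF <= delta] makes [kappa] positive would do. *)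
exists 20^-1, 1; split; first by rewrite invr_gt0.
split=> [|LF eta rho tau LF0 eta_b /andP[rho1 rho2] /andP[tau0 tau1]]; first exact: ltr01.
have d0 : (0 : R) < 20^-1 by rewrite invr_gt0.
have eta0 : 0 < eta by have /andP[] := eta_b.
(* With [c_delta = 1] the square root equals [delta]. *)
have tauLF : tau * LF <= 20^-1.
  by move: tau1; rewrite mul1r sqrtr_sqr gtr0_norm // ler_pdivlMr.
have rho_eta : 8 * rho * eta ^+ 2 <= 1.
  move: rho2; rewrite -[X in _ <= X -> _]mul1r ler_pdivlMr ?mulr_gt0 ?exprn_gt0 //.
  by rewrite mulrCA mulrA.
have kappa0 := kappa_gt0 LF0 tau0 tauLF.
set kappa := (_ - _ - _) / 2 in kappa0.
pose Lt := Ltilde LF tau 20^-1.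
have Lt0 : 0 < Lt.
  by rewrite /Lt /Ltilde !addr_gt0 ?divr_gt0 ?mulr_gt0 ?exprn_gt0.
pose A1 : R := 2 * LF ^+ 2 + 2 * tau ^+ 2 * LF ^+ 2.
pose A2 : R := 2 / tau ^+ 2 + 2 + 2 * tau ^+ 2 * LF ^+ 2.
have A10 : 0 < A1 by rewrite /A1 !(addr_gt0, mulr_gt0, exprn_gt0).
have A20 : 0 < A2 by rewrite /A2 !(addr_gt0, divr_gt0, mulr_gt0, exprn_gt0).
pose C0 := 2 * Lt / eta + 8 * A1 * eta / Lt + 2 * A2 / kappa.
have C00 : 0 < C0.
  rewrite /C0 addr_gt0 //; last by rewrite divr_gt0 // mulr_gt0.
  by rewrite addr_gt0 // divr_gt0 // mulr_gt0 // mulr_gt0.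
exists C0, (C0 * (eta / Lt)); split => //; split; first by rewrite mulr_gt0 // divr_gt0.
move=> X n d p sigma2 cb b x1 B0 B1 L1 Psistar std _ unb mss cb0 b0 index0.
have [s20 _] := unb.
pose V := sigma2 / (4 * rho * eta ^+ 2 * cb) + 32 * rho * eta ^+ 2 * sigma2 / b%:R.
(* Replacing the gap by its bound makes [C] independent of [eps], [T] and the sample space. *)
pose Gmax := C0 * gap_bound p LF tau 20^-1 x1 B0 B1 L1 Psistar + C0 * (eta / Lt) * V.
exists (2 * n%:R * (Gmax `^ (3 / 2) + 1)), 1.
have n0 : 0 < n%:R :> R by rewrite ltr0n; exact: std_n std.
split; first by rewrite !mulr_gt0 // ltr_wpDl // powR_ge0.
split=> // eps T disp Omega P S r x D B L eps0 T0 smp B_0 path _ Psi_lower gap Teq.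
have [gap0 gap1 hint] := rate std unb mss tau0 d0 index0 kappa0 eta_b rho1 rho_eta
  cb0 b0 T0 smp B_0 path Psi_lower.
rewrite -/gap in gap0 gap1 hint.
pose G := C0 * gap + C0 * (eta / Lt) * V.
have rho0 : 0 < rho by apply: lt_le_trans rho1.
have V0 : 0 <= V.
  rewrite /V addr_ge0 // divr_ge0 // ?ler0n //.
    by rewrite !mulr_ge0 ?sqr_ge0 // ltW.
  by rewrite !mulr_ge0 ?sqr_ge0 // ltW.
have G0 : 0 <= G.
  apply: addr_ge0; first exact: mulr_ge0 (ltW C00) gap0.
  by apply: mulr_ge0 => //; apply: ltW; rewrite mulr_gt0 // divr_gt0.
rewrite -/V -/G in Teq.
set t : R := T%:R `^ (3^-1) in hint.
have t1 : 1 <= t := powR_cube_root_ge1 T0.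
have t0 : 0 < t by apply: lt_le_trans t1.
have TR : T%:R = (Num.ceil (G `^ (3 / 2) / eps ^+ 3))%:~R :> R by rewrite -Teq.
split.
  apply: le_trans hint _; rewrite lee_fin.
  have -> : (2 * Ltilde LF tau 20^-1 / eta + 8 * (2 * LF ^+ 2 + 2 * tau ^+ 2 * LF ^+ 2) * eta
      / Ltilde LF tau 20^-1 + 2 * (2 / tau ^+ 2 + 2 + 2 * tau ^+ 2 * LF ^+ 2) / kappa)
      * (gap + eta / Ltilde LF tau 20^-1 * V) = G.
    by rewrite -/Lt -/A1 -/A2 -/C0 /G mulrDr mulrA.
  apply: le_sq_of_powR => //.
  by rewrite powR_cube_root TR ceil_ge.
move=> eps1.
(* For [eps < 1] the unit lost in rounding [T] up is absorbed into [eps^-3]. *)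
have ie : 1 <= (eps ^+ 3)^-1.
  by rewrite invf_ge1 ?exprn_gt0 // exprn_ile1 ?(ltW eps0) ?(ltW eps1).
have Gm : G `^ (3 / 2) <= Gmax `^ (3 / 2).
  have GG : G <= Gmax by rewrite /G /Gmax lerD2r ler_pM2l.
  have Gn : G \is Num.nneg by [].
  have Gmn : Gmax \is Num.nneg by exact: le_trans G0 GG.
  by apply: (ge0_ler_powR _ Gn Gmn GG); rewrite divr_ge0.
have Tle : T%:R <= (Gmax `^ (3 / 2) + 1) / eps ^+ 3.
  have : T%:R < G `^ (3 / 2) / eps ^+ 3 + 1.
    by rewrite TR; have := ceilB1_lt (G `^ (3 / 2) / eps ^+ 3); rewrite intrB ltrBlDr.
  have : G `^ (3 / 2) / eps ^+ 3 <= Gmax `^ (3 / 2) / eps ^+ 3.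
    by rewrite ler_pM2r // invr_gt0 exprn_gt0.
  rewrite mulrDl mul1r; lra.
apply: (@le_trans _ _ (2 * n%:R * T%:R)).
  by rewrite -!natrM ler_nat sfo_calls_le.
by rewrite -[leRHS]mulrA ler_pM2l // mulr_gt0.
Qed.
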